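(* There is an action of the braid group on a Hermitian vector space with mixed signature coming from the singular part of the category of (finite-dimensional weight) modules over the unrolled quantum group of $\mathfrak{sl}_2$ at a fourth root of unity, namely on a space of the form $\mathcal H_{n,0}=\operatorname{Hom}(V_0,V_0^{\otimes(2n+1)})$. The image of the braid group in the corresponding indefinite unitary group is infinite but not dense in general.
   Context: Put $q=e^{\pi i/2}$, $q^x=e^{\pi i x/2}$, $\{x\}=q^x-q^{-x}$. The unrolled quantum group is the Hopf algebra over $\mathbb C$ generated by $E,F,K^{\pm1},H$ with relations $KK^{-1}=K^{-1}K=1$, $KEK^{-1}=q^2E$, $KFK^{-1}=q^{-2}F$, $[E,F]=\frac{K-K^{-1}}{q-q^{-1}}$, $HK=KH$, $[H,E]=2E$, $[H,F]=-2F$, $E^2=F^2=0$, and coproduct $\Delta(E)=1\otimes E+E\otimes K$, $\Delta(F)=K^{-1}\otimes F+F\otimes 1$, $\Delta(K)=K\otimes K$, $\Delta(H)=H\otimes1+1\otimes H$. A weight module is a finite-dimensional module on which $H$ is diagonalizable and $K=q^H$; $\operatorname{Hom}$ means module homomorphisms. The category of weight modules is graded by $\mathbb C/2\mathbb Z$: the part of degree $g$ consists of the modules all of whose $H$-weights lie in the class $g$ mod $2\mathbb Z$. The singular part of the category is the part with $g\in\{0,1\}$, that is, with integral weights. $V_0$ is the (singular) module with basis $v_0,v_1$ and $Hv_0=v_0$, $Hv_1=-v_1$, $Ev_0=0$, $Ev_1=v_0$, $Fv_0=v_1$, $Fv_1=0$. The braiding is $c_{V,W}=\tau\circ R:V\otimes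 W\to W\otimes V$, where $R=q^{H\otimes H/2}(1+\{1\}E\otimes F)$, $q^{H\otimes H/2}$ multiplies a tensor of weight vectors of weights $\lambda,\lambda'$ by $q^{\lambda\lambda'/2}$, and $\tau$ is the flip. The generator $\sigma_i$ of the braid group on $2n+1$ strands acts on $\mathcal H_{n,0}$ by post-composition with $c_{V_0,V_0}$ in tensor positions $i,i+1$. ''Hermitian vector space with mixed signature'' means a finite-dimensional complex vector space with a non-degenerate indefinite Hermitian form; the corresponding indefinite unitary group is the group of linear automorphisms preserving the form, and the braid group acts through it. *)

(* Defs.v *)
From HB Require Import structures.
From mathcomp Require Import all_boot all_order all_algebra.
From mathcomp Require Import generic_quotient sesquilinear complex mxtens ring.
From mathcomp Require Import all_classical all_reals all_analysis.
Import Order.TTheory GRing.Theory Num.Theory.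
Import numFieldNormedType.Exports.

Set Implicit Arguments.
Unset Strict Implicit.
Unset Printing Implicit Defensive.

Local Open Scope classical_set_scope.
Local Open Scope ring_scope.

(* Linear maps k^n -> k^m are m x n matrices acting on column vectors, so a
   product of algebra elements acts by the product of their matrices. The tensor
   product of linear maps is the Kronecker product *t, in the basis of the
   e_i (x) e_j enumerated by mxtens_index. *)

Section TensorAlgebra.
Variable A : comNzRingType.

Lemma tensmxDl m n p r (M M' : 'M[A]_(m, n)) (N : 'M[A]_(p, r)) :
  (M + M') *t N = M *t N + M' *t N.
Proof. by apply/matrixP=> i j; rewrite !mxE mulrDl. Qed.

Lemma tensmxDr m n p r (M : 'M[A]_(m, n)) (N N' : 'M[A]_(p, r)) :
  M *t (N + N') = M *t N + M *t N'.
Proof. by apply/matrixP=> i j; rewrite !mxE mulrDr. Qed.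

Lemma tensmxZl m n p r c (M : 'M[A]_(m, n)) (N : 'M[A]_(p, r)) :
  (c *: M) *t N = c *: (M *t N).
Proof. by apply/matrixP=> i j; rewrite !mxE mulrA. Qed.

Lemma tensmxZr m n p r c (M : 'M[A]_(m, n)) (N : 'M[A]_(p, r)) :
  M *t (c *: N) = c *: (M *t N).
Proof. by apply/matrixP=> i j; rewrite !mxE mulrCA. Qed.

Lemma tensmxBl m n p r (M M' : 'M[A]_(m, n)) (N : 'M[A]_(p, r)) :
  (M - M') *t N = M *t N - M' *t N.
Proof. by rewrite tensmxDl -scaleN1r tensmxZl scaleN1r. Qed.

Lemma tensmxBr m n p r (M : 'M[A]_(m, n)) (N N' : 'M[A]_(p, r)) :
  M *t (N - N') = M *t N - M *t N'.
Proof. by rewrite tensmxDr -scaleN1r tensmxZr scaleN1r. Qed.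

Lemma tensmx_diag m n (d : 'rV[A]_m) (e : 'rV[A]_n) :
  diag_mx d *t diag_mx e =
  diag_mx (\row_k (d 0 (mxtens_unindex k).1 * e 0 (mxtens_unindex k).2)).
Proof.
apply/matrixP=> i j; case: (mxtens_indexP i) => a b; case: (mxtens_indexP j) => a' b'.
rewrite tensmxE !mxE (can_eq (@mxtens_indexK m n)) mxtens_indexK xpair_eqE /=.
by case: (a == a'); case: (b == b'); rewrite ?mulr1n ?mulr0n ?mul0r ?mulr0.
Qed.

Lemma tensmx11 m n : (1%:M : 'M[A]_m) *t (1%:M : 'M[A]_n) = 1%:M.
Proof.
rewrite -!diag_const_mx tensmx_diag; congr diag_mx.
by apply/rowP=> k; rewrite !mxE mulr1.
Qed.

End TensorAlgebra.

Section QuantumRelations.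
Variables (k : fieldType) (q : k).

Record uq_relations d (E F K Ki H : 'M[k]_d) : Prop := UqRelations {
  uqKKi : K *m Ki = 1%:M;
  uqKiK : Ki *m K = 1%:M;
  uqKE : K *m E *m Ki = q ^+ 2 *: E;
  uqKF : K *m F *m Ki = q ^- 2 *: F;
  uqEF : E *m F - F *m E = (q - q^-1)^-1 *: (K - Ki);
  uqHK : H *m K = K *m H;
  uqHE : H *m E - E *m H = 2 *: E;
  uqHF : H *m F - F *m H = (- 2) *: F;
  uqEE : E *m E = 0;
  uqFF : F *m F = 0
}.

(* The columns of P form a basis of H-weight vectors, of weights d, on which
   K acts as q^H, where qp x stands for q^x. *)
Record weight_basis (qp : k -> k) d (K H P : 'M[k]_d) (w : 'rV[k]_d) : Prop :=
    WeightBasis {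
  wb_unit : P \in unitmx;
  wb_H : H *m P = P *m diag_mx w;
  wb_K : K *m P = P *m diag_mx (map_mx qp w)
}.

Lemma tens_uq_relations m n (E F K Ki H : 'M[k]_m) (E' F' K' Ki' H' : 'M[k]_n) :
  q ^+ 2 = - 1 ->
  uq_relations E F K Ki H -> uq_relations E' F' K' Ki' H' ->
  uq_relations (1%:M *t E' + E *t K') (Ki *t F' + F *t 1%:M) (K *t K')
    (Ki *t Ki') (H *t 1%:M + 1%:M *t H').
Proof.
move=> q2 [KKi KiK KE KF EF HK HE HF EE FF] [KKi' KiK' KE' KF' EF' HK' HE' HF' EE' FF'].
have qm2 : q ^- 2 = - 1 by rewrite q2 invrN1.
rewrite qm2 in KF KF'; rewrite q2 in KE KE'.
have KEc d (A B X : 'M[k]_d) : A *m X *m B = -1 *: X -> B *m A = 1%:M -> A *m X = - (X *m A).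
  move=> e1 e2; rewrite -[A *m X]mulmx1 -e2 mulmxA e1.
  by rewrite -scalemxAl scaleN1r.
have XKi d (A B X : 'M[k]_d) : A *m X = - (X *m A) -> B *m A = 1%:M -> A *m B = 1%:M ->
    B *m X = - (X *m B).
  move=> e1 e2 e3; rewrite -[B *m X]mulmx1 -e3 -mulmxA (mulmxA X) -[X *m A]opprK -e1.
  by rewrite mulNmx mulmxN !mulmxA e2 mul1mx.
have EK := KEc _ _ _ _ KE KiK; have EK' := KEc _ _ _ _ KE' KiK'.
have FK := KEc _ _ _ _ KF KiK; have FK' := KEc _ _ _ _ KF' KiK'.
have EKi := XKi _ _ _ _ EK KiK KKi; have FKi := XKi _ _ _ _ FK KiK KKi.
have HKi : H *m Ki = Ki *m H.
  by rewrite -[LHS]mul1mx -KiK -mulmxA (mulmxA K) -HK -(mulmxA H) KKi mulmx1.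
split.
- by rewrite tensmx_mul KKi KKi' tensmx11.
- by rewrite tensmx_mul KiK KiK' tensmx11.
- rewrite mulmxDr !tensmx_mul mulmxDl !tensmx_mul mulmx1 KKi KE KE' q2.
  by rewrite -(mulmxA K') KKi' mulmx1 tensmxZl tensmxZr scalerDr.
- rewrite mulmxDr !tensmx_mul mulmxDl !tensmx_mul mulmx1 KKi' KF KF' qm2.
  by rewrite KKi mul1mx tensmxZl tensmxZr scalerDr.
- rewrite !mulmxDr !mulmxDl !tensmx_mul !mul1mx !mulmx1.
  have -> : E' *m F' = F' *m E' + (q - q^-1)^-1 *: (K' - Ki').
    by rewrite -EF' addrC subrK.
  have -> : E *m F = F *m E + (q - q^-1)^-1 *: (K - Ki).
    by rewrite -EF addrC subrK.
  rewrite EKi FK' -!scaleN1r !(tensmxDl, tensmxDr, tensmxZl, tensmxZr).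
  by apply/matrixP=> i j; rewrite !(mxE, scaleN1r); ring.
- by rewrite mulmxDl mulmxDr !tensmx_mul !mul1mx !mulmx1 HK HK'.
- rewrite !mulmxDl !mulmxDr !tensmx_mul !mul1mx !mulmx1 HK'.
  have -> : H *m E = E *m H + 2 *: E by rewrite -HE addrC subrK.
  have -> : H' *m E' = E' *m H' + 2 *: E' by rewrite -HE' addrC subrK.
  rewrite !(tensmxDl, tensmxDr, tensmxZl, tensmxZr).
  by apply/matrixP=> i j; rewrite !mxE; ring.
- rewrite !mulmxDl !mulmxDr !tensmx_mul !mul1mx !mulmx1 HKi.
  have -> : H *m F = F *m H + (- 2) *: F by rewrite -HF addrC subrK.
  have -> : H' *m F' = F' *m H' + (- 2) *: F' by rewrite -HF' addrC subrK.
  rewrite !(tensmxDl, tensmxDr, tensmxZl, tensmxZr).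
  by apply/matrixP=> i j; rewrite !mxE; ring.
- rewrite !mulmxDl !mulmxDr !tensmx_mul !mul1mx !mulmx1 EE EE' EK'.
  rewrite -scaleN1r tensmxZr.
  by apply/matrixP=> i j; rewrite !mxE; ring.
- rewrite !mulmxDl !mulmxDr !tensmx_mul !mul1mx !mulmx1 FF FF' FKi.
  rewrite -scaleN1r tensmxZl.
  by apply/matrixP=> i j; rewrite !mxE; ring.
Qed.

Lemma tens_weight_basis (qp : k -> k) m n (K H P : 'M[k]_m) (w : 'rV[k]_m)
    (K' H' P' : 'M[k]_n) (w' : 'rV[k]_n) :
  {morph qp : x y / x + y >-> x * y} ->
  weight_basis qp K H P w -> weight_basis qp K' H' P' w' ->
  weight_basis qp (K *t K') (H *t 1%:M + 1%:M *t H') (P *t P')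
    (\row_j (w 0 (mxtens_unindex j).1 + w' 0 (mxtens_unindex j).2)).
Proof.
move=> qpD [uP HP KP] [uP' HP' KP']; split.
- suff : (invmx P *t invmx P') *m (P *t P') = 1%:M by case/mulmx1_unit.
  by rewrite tensmx_mul !mulVmx // tensmx11.
- rewrite mulmxDl !tensmx_mul HP HP' !mul1mx.
  rewrite -[P' in X in X + _]mulmx1 -[P in X in _ + X]mulmx1 -!tensmx_mul -mulmxDr.
  rewrite -!diag_const_mx !tensmx_diag -raddfD /=; congr (_ *m diag_mx _).
  by apply/rowP=> j; rewrite !mxE mul1r mulr1.
- rewrite !tensmx_mul KP KP' -tensmx_mul tensmx_diag; congr (_ *m diag_mx _).
  by apply/rowP=> j; rewrite !mxE qpD.
Qed.

End QuantumRelations.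
Lemma V0_relations_field (k : fieldType) (q : k) :
  q ^+ 2 = - 1 -> (2 : k) != 0 ->
  uq_relations q (delta_mx 0 1 : 'M[k]_2) (delta_mx 1 0)
    (diag_mx (\row_j (if j == 0 then q else - q)))
    (diag_mx (\row_j (if j == 0 then - q else q)))
    (diag_mx (\row_j (-1) ^+ (j : 'I_2))).
Proof.
move=> q2 two_neq0.
have qm2 : q ^- 2 = - 1 by rewrite q2 invrN1.
have q0 : q != 0.
  by apply/eqP=> q0; move/eqP: q2; rewrite q0 expr0n /= eq_sym oppr_eq0 oner_eq0.
have qV : q^-1 = - q.
  by apply: (mulfI q0); rewrite divff // mulrN -expr2 q2 opprK.
have qq : q * q = - 1 by rewrite -expr2.
have qqV : (q - q^-1)^-1 * (q + q) = 1.
  by rewrite qV opprK mulVf // -mulr2n -mulr_natr mulf_neq0.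
have dqV : diag_mx (\row_j (if j == 0 then q else - q)) -
           diag_mx (\row_j (if j == 0 then - q else q)) =
           (q + q) *: diag_mx (\row_j (-1) ^+ (j : 'I_2)).
  apply/matrixP=> i j; rewrite !mxE.
  case: (i == j); last by rewrite !mulr0n subr0 mulr0.
  by case: i => [[|[|//]] ?] /=; rewrite ?mulr1n ?expr0 ?expr1; ring.
split; rewrite ?dqV ?scalerA ?qqV ?scale1r ?q2 ?qm2;
  apply/matrixP=> i j; case: i => [[|[|//]] ?]; case: j => [[|[|//]] ?];
  rewrite !mxE !big_ord_recl !big_ord0 /= !mxE /=
    ?(big_ord_recl, big_ord0, mxE) /= ?(big_ord_recl, big_ord0, mxE) /=;
  rewrite ?(mulr1n, mulr0n, mulr0, mul0r, addr0, add0r, mul1r, mulr1, mulNr, mulrN,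
    qq, opprK, subrr, oppr0, expr0, expr1, subr0, sub0r) //; try ring.
by rewrite invrN1.
Qed.

Lemma weight_basis_tens_eigen (k : fieldType) (qp : k -> k) (f : k -> k -> k) m n
    (K H P : 'M[k]_m) (d : 'rV[k]_m) (K' H' P' : 'M[k]_n) (d' : 'rV[k]_n)
    (l l' : k) (v : 'cV[k]_m) (w : 'cV[k]_n) :
  weight_basis qp K H P d -> weight_basis qp K' H' P' d' ->
  H *m v = l *: v -> H' *m w = l' *: w ->
  (P *t P') *m
    diag_mx (\row_j f (d 0 (mxtens_unindex j).1) (d' 0 (mxtens_unindex j).2)) *m
    invmx (P *t P') *m (v *t w) = f l l' *: (v *t w).
Proof.
move=> [uP HP _] [uP' HP' _] Hv Hw.
have coords e (X Q : 'M[k]_e) (g : 'rV[k]_e) (c : k) (x : 'cV[k]_e) :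
    Q \in unitmx -> X *m Q = Q *m diag_mx g -> X *m x = c *: x ->
    forall i, g 0 i * (invmx Q *m x) i 0 = c * (invmx Q *m x) i 0.
  move=> uQ XQ Xx i.
  have : diag_mx g *m (invmx Q *m x) = c *: (invmx Q *m x).
    apply: (can_inj (mulKmx uQ)); rewrite mulmxA -XQ -!mulmxA (mulKVmx uQ) Xx.
    by rewrite -!scalemxAr (mulKVmx uQ).
  by move/matrixP/(_ i 0); rewrite mul_diag_mx !mxE.
have ca := coords _ _ _ _ _ _ uP HP Hv; have cb := coords _ _ _ _ _ _ uP' HP' Hw.
set a := invmx P *m v in ca; set b := invmx P' *m w in cb.
have uPP : P *t P' \in unitmx.
  suff : (invmx P *t invmx P') *m (P *t P') = 1%:M by case/mulmx1_unit.
  by rewrite tensmx_mul !mulVmx // tensmx11.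
have -> : v *t w = (P *t P') *m (a *t b).
  by rewrite tensmx_mul /a /b !mulKVmx.
rewrite -!mulmxA (mulKmx uPP) scalemxAr; congr (_ *m _).
clearbody a b; apply/matrixP=> i j; rewrite mul_diag_mx !mxE.
case: (mxtens_indexP i) => i1 i2; case: (mxtens_indexP j) => j1 j2.
rewrite !mxtens_indexK /= (ord1 j1) (ord1 j2).
have [->|a0] := eqVneq (a i1 0) 0; first by rewrite mul0r !mulr0.
have [->|b0] := eqVneq (b i2 0) 0; first by rewrite !mulr0.
by have /(mulIf a0)-> := ca i1; have /(mulIf b0)-> := cb i2.
Qed.

Section Intertwiners.
Variable k : fieldType.

Definition intertwiners m n (M : 'M[k]_n) (N : 'M[k]_m) : {vspace 'M[k]_(m, n)} :=
  lker (linfun (mulmxr M \- mulmx N)).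

Lemma intertwinersP m n (M : 'M[k]_n) (N : 'M[k]_m) (f : 'M[k]_(m, n)) :
  reflect (f *m M = N *m f) (f \in intertwiners M N).
Proof. by rewrite memv_ker lfunE /= subr_eq0; apply: eqP. Qed.

End Intertwiners.

Section WeightModules.
Variable R : realType.
Local Notation C := R[i].

Definition cexp (z : C) : C :=
  (expR (complex.Re z))%:C%C * (cos (complex.Im z) +i* sin (complex.Im z))%C.

Definition qpow (x : C) : C := cexp ((pi : R)%:C%C * 'i%C * x / 2).
Definition qbrace (x : C) : C := qpow x - qpow (- x).
Local Notation q := (qpow 1).

Lemma cexp_pi2 (x : R) :
  cexp ((pi : R)%:C%C * 'i%C * x%:C%C / 2) =
  (cos (pi * x / 2) +i* sin (pi * x / 2))%C.
Proof.
have -> : (pi : R)%:C%C * 'i%C * x%:C%C / 2 = (0 +i* (pi * x / 2))%C :> C.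
  have -> : (2 : C) = (2 : R)%:C%C by rewrite rmorph_nat.
  by rewrite -fmorphV /=; simpc.
by rewrite /cexp /= expR0 rmorph1 mul1r.
Qed.

Lemma qpow1E : q = 'i%C.
Proof.
have -> : (1 : C) = (1 : R)%:C%C by [].
by rewrite /qpow cexp_pi2 mulr1 cos_pihalf sin_pihalf.
Qed.

Lemma qpowN1E : qpow (- 1) = (- 'i)%C.
Proof.
have -> : (- 1 : C) = (- 1 : R)%:C%C by rewrite rmorphN rmorph1.
rewrite /qpow cexp_pi2 mulrN1 mulNr cosN sinN cos_pihalf sin_pihalf.
by simpc.
Qed.

Lemma cexpD (x y : C) : cexp (x + y) = cexp x * cexp y.
Proof.
case: x y => [a b] [c d]; rewrite /cexp /= expRD cosD sinD rmorphM.
rewrite [in RHS]mulrACA; congr (_ * _).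
by simpc; congr (_ +i* _)%C; rewrite addrC.
Qed.

Lemma qpowD (x y : C) : qpow (x + y) = qpow x * qpow y.
Proof. by rewrite /qpow -cexpD mulrDr mulrDl. Qed.

Lemma qpow0 : qpow 0 = 1.
Proof.
by rewrite /qpow mulr0 mul0r /cexp /= expR0 cos0 sin0 rmorph1 mul1r.
Qed.

Lemma q2E : q ^+ 2 = - 1.
Proof. by rewrite qpow1E sqr_i. Qed.

(* A weight module with underlying space C^wdim. The weight basis is only used
   to write down q^(H (x) H / 2), which does not depend on it (lemma qHH_weight);
   morphisms ignore it. *)
Record wmod := Wmod {
  wdim : nat;
  actE : 'M[C]_wdim;
  actF : 'M[C]_wdim;
  actK : 'M[C]_wdim;
  actKi : 'M[C]_wdim;
  actH : 'M[C]_wdim;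
  wbasis : 'M[C]_wdim;
  wts : 'rV[C]_wdim;
  wmod_rel : uq_relations q actE actF actK actKi actH;
  wmod_basis : weight_basis qpow actK actH wbasis wts
}.

Definition is_weight (V : wmod) (l : C) : Prop :=
  exists2 v : 'cV[C]_(wdim V), v != 0 & actH V *m v = l *: v.

Definition in_degree (g : C) (V : wmod) : Prop :=
  forall l, is_weight V l -> exists z : int, l = g + 2 * z%:~R.

Definition singular (V : wmod) : Prop := in_degree 0 V \/ in_degree 1 V.

Definition module_hom (V W : wmod) : {vspace 'M[C]_(wdim W, wdim V)} :=
  (intertwiners (actE V) (actE W) :&: intertwiners (actF V) (actF W) :&:
   intertwiners (actK V) (actK W) :&: intertwiners (actKi V) (actKi W) :&:
   intertwiners (actH V) (actH W))%VS.

Lemma module_homP (V W : wmod) (f : 'M[C]_(wdim W, wdim V)) :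
  reflect [/\ f *m actE V = actE W *m f, f *m actF V = actF W *m f,
              f *m actK V = actK W *m f, f *m actKi V = actKi W *m f
            & f *m actH V = actH W *m f]
          (f \in module_hom V W).
Proof.
rewrite /module_hom 4!memv_cap.
apply: (iffP idP) => [/andP[/andP[/andP[/andP[]]]]|[fE fF fK fKi fH]].
  move=> /intertwinersP fE /intertwinersP fF /intertwinersP fK.
  move=> /intertwinersP fKi /intertwinersP fH.
  exact: And5 fE fF fK fKi fH.
apply/andP; split; last exact: (introT (intertwinersP _ _ _) fH).
apply/andP; split; last exact: (introT (intertwinersP _ _ _) fKi).
apply/andP; split; last exact: (introT (intertwinersP _ _ _) fK).
apply/andP; split; first exact: (introT (intertwinersP _ _ _) fE).
exact: (introT (intertwinersP _ _ _) fF).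
Qed.

Definition tens (V W : wmod) : wmod := {|
  wdim := wdim V * wdim W;
  actE := 1%:M *t actE W + actE V *t actK W;
  actF := actKi V *t actF W + actF V *t 1%:M;
  actK := actK V *t actK W;
  actKi := actKi V *t actKi W;
  actH := actH V *t 1%:M + 1%:M *t actH W;
  wbasis := wbasis V *t wbasis W;
  wts := \row_j (wts V 0 (mxtens_unindex j).1 + wts W 0 (mxtens_unindex j).2);
  wmod_rel := tens_uq_relations q2E (wmod_rel V) (wmod_rel W);
  wmod_basis := tens_weight_basis qpowD (wmod_basis V) (wmod_basis W)
|}.

Lemma unit_uq_relations : uq_relations q (0 : 'M[C]_1) 0 1%:M 1%:M 0.
Proof.
by split; rewrite ?(mulmx0, mul0mx, mulmx1, mul1mx, scaler0, subrr).
Qed.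

Lemma unit_weight_basis : weight_basis qpow 1%:M (0 : 'M[C]_1) 1%:M 0.
Proof.
split; first exact: unitmx1.
  by rewrite mul0mx mul1mx raddf0.
rewrite !mul1mx -diag_const_mx; congr diag_mx.
by apply/rowP=> j; rewrite !mxE qpow0.
Qed.

Definition unit_wmod : wmod := {|
  wdim := 1;
  actE := 0;
  actF := 0;
  actK := 1%:M;
  actKi := 1%:M;
  actH := 0;
  wbasis := 1%:M;
  wts := 0;
  wmod_rel := unit_uq_relations;
  wmod_basis := unit_weight_basis
|}.

Fixpoint tpow (V : wmod) (m : nat) : wmod :=
  if m is m'.+1 then tens V (tpow V m') else unit_wmod.

Definition V0_wts : 'rV[C]_2 := \row_j (-1) ^+ j.

Lemma V0_uq_relations :
  uq_relations q (delta_mx 0 1 : 'M[C]_2) (delta_mx 1 0)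
    (diag_mx (map_mx qpow V0_wts)) (diag_mx (map_mx qpow (- V0_wts)))
    (diag_mx V0_wts).
Proof.
have -> : map_mx qpow V0_wts = \row_j (if j == 0 then q else - q).
  apply/rowP=> j; rewrite !mxE; case: j => [[|[|//]] ?] /=; first by rewrite expr0.
  by rewrite expr1 qpowN1E qpow1E.
have -> : map_mx qpow (- V0_wts) = \row_j (if j == 0 then - q else q).
  apply/rowP=> j; rewrite !mxE; case: j => [[|[|//]] ?] /=.
    by rewrite expr0 qpowN1E qpow1E.
  by rewrite expr1 opprK.
apply: V0_relations_field; first exact: q2E.
by rewrite pnatr_eq0.
Qed.

Lemma V0_weight_basis :
  weight_basis qpow (diag_mx (map_mx qpow V0_wts)) (diag_mx V0_wts) 1%:M V0_wts.
Proof. by split; rewrite ?unitmx1 ?mulmx1 ?mul1mx. Qed.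

Definition V0 : wmod := {|
  wdim := 2;
  actE := delta_mx 0 1;
  actF := delta_mx 1 0;
  actK := diag_mx (map_mx qpow V0_wts);
  actKi := diag_mx (map_mx qpow (- V0_wts));
  actH := diag_mx V0_wts;
  wbasis := 1%:M;
  wts := V0_wts;
  wmod_rel := V0_uq_relations;
  wmod_basis := V0_weight_basis
|}.

Definition qHH (V W : wmod) : 'M[C]_(wdim V * wdim W) :=
  (wbasis V *t wbasis W) *m
  diag_mx (\row_j qpow (wts V 0 (mxtens_unindex j).1 *
                        wts W 0 (mxtens_unindex j).2 / 2)) *m
  invmx (wbasis V *t wbasis W).

Lemma qHH_weight (V W : wmod) (l l' : C) (v : 'cV[C]_(wdim V)) (w : 'cV[C]_(wdim W)) :
  actH V *m v = l *: v -> actH W *m w = l' *: w ->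
  qHH V W *m (v *t w) = qpow (l * l' / 2) *: (v *t w).
Proof.
exact: (weight_basis_tens_eigen (fun x y => qpow (x * y / 2))
  (wmod_basis V) (wmod_basis W)).
Qed.

Definition Rmx (V W : wmod) : 'M[C]_(wdim V * wdim W) :=
  qHH V W *m (1%:M + qbrace 1 *: (actE V *t actF W)).

Definition flip (m n : nat) : 'M[C]_(n * m, m * n) :=
  \matrix_(i, j) (mxtens_unindex i ==
                  ((mxtens_unindex j).2, (mxtens_unindex j).1))%:R.

Definition braiding (V W : wmod) : 'M[C]_(wdim W * wdim V, wdim V * wdim W) :=
  flip (wdim V) (wdim W) *m Rmx V W.

(* The braiding c_{V,V} in tensor positions i, i+1 (counted from 0) of V^{(x) m};
   it is only meaningful for i + 1 < m. Since mxtens_index sends (i, j) to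
   i * n + j, the associator (V (x) V) (x) X -> V (x) (V (x) X) is a cast. *)
Fixpoint braid_at (V : wmod) (m i : nat) : 'M[C]_(wdim (tpow V m)) :=
  match m, i with
  | m'.+2, 0 =>
    castmx (esym (mulnA _ _ _), esym (mulnA _ _ _))
      (braiding V V *t (1%:M : 'M[C]_(wdim (tpow V m'))))
  | m'.+1, i'.+1 => 1%:M *t braid_at V m' i'
  | _, _ => 1%:M
  end.

Definition Hspace (n : nat) : vectType C :=
  subvs_of (module_hom V0 (tpow V0 n.*2.+1)).

End WeightModules.

Arguments V0 {R}.

(* Words in the generators of the braid group on m strands: (i, true) stands for
   sigma_i and (i, false) for its inverse, sigma_i involving the strands i and
   i + 1, counted from 0. *)
Definition braid_word (m : nat) := seq ('I_m.-1 * bool).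

Inductive braid_eq (m : nat) : braid_word m -> braid_word m -> Prop :=
| braid_refl u : braid_eq u u
| braid_sym u v : braid_eq u v -> braid_eq v u
| braid_trans u v w : braid_eq u v -> braid_eq v w -> braid_eq u w
| braid_cat u u' v v' : braid_eq u u' -> braid_eq v v' -> braid_eq (u ++ v) (u' ++ v')
| braid_cancel i b : braid_eq [:: (i, b); (i, ~~ b)] [::]
| braid_far (i j : 'I_m.-1) : (i.+1 < j)%N ->
    braid_eq [:: (i, true); (j, true)] [:: (j, true); (i, true)]
| braid_near (i j : 'I_m.-1) : j = i.+1 :> nat ->
    braid_eq [:: (i, true); (j, true); (i, true)] [:: (j, true); (i, true); (j, true)].

Section BraidGroup.
Variable m : nat.

Definition braid_eqb (u v : braid_word m) : bool := `[< braid_eq u v >].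

Lemma braid_eqb_refl : reflexive braid_eqb.
Proof. by move=> u; apply/asboolP; exact: braid_refl. Qed.

Lemma braid_eqb_sym : symmetric braid_eqb.
Proof. by move=> u v; apply/asboolP/asboolP; exact: braid_sym. Qed.

Lemma braid_eqb_trans : transitive braid_eqb.
Proof.
by move=> v u w /asboolP uv /asboolP vw; apply/asboolP; exact: braid_trans uv vw.
Qed.

Canonical braid_equiv := EquivRel braid_eqb braid_eqb_refl braid_eqb_sym braid_eqb_trans.

Definition braid_group := {eq_quot braid_equiv}%qT.
HB.instance Definition _ := Choice.on braid_group.

Definition braid_of (w : braid_word m) : braid_group := \pi_(braid_group)%qT w.

Definition braid_inv_word (w : braid_word m) : braid_word m :=
  rev [seq (x.1, ~~ x.2) | x <- w].

Definition braid_one : braid_group := braid_of [::].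
Definition braid_mul (x y : braid_group) : braid_group := braid_of (repr x ++ repr y).
Definition braid_inv (x : braid_group) : braid_group := braid_of (braid_inv_word (repr x)).

Lemma braid_ofP u v : reflect (braid_of u = braid_of v) (braid_eqb u v).
Proof. by apply: (iffP idP) => /eqmodP. Qed.

Lemma braid_ofK x : braid_of (repr x) = x.
Proof. exact: reprK. Qed.

Lemma repr_braid_of w : braid_eq (repr (braid_of w)) w.
Proof. by apply/asboolP/braid_ofP; rewrite braid_ofK. Qed.

Lemma braid_ofM u v : braid_mul (braid_of u) (braid_of v) = braid_of (u ++ v).
Proof. by apply/braid_ofP/asboolP/braid_cat; exact: repr_braid_of. Qed.

Lemma braid_mulA : associative braid_mul.
Proof.
move=> x y z; rewrite -(braid_ofK x) -(braid_ofK y) -(braid_ofK z).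
by rewrite !braid_ofM catA.
Qed.

Lemma braid_mul1 : left_id braid_one braid_mul.
Proof. by move=> x; rewrite -(braid_ofK x) braid_ofM. Qed.

Lemma braid_mulr1 : right_id braid_one braid_mul.
Proof. by move=> x; rewrite -(braid_ofK x) braid_ofM cats0. Qed.

Lemma braid_word_invK w : braid_inv_word (braid_inv_word w) = w.
Proof.
rewrite /braid_inv_word map_rev revK -map_comp -[RHS]map_id.
by apply: eq_map => -[i b] /=; rewrite negbK.
Qed.

Lemma braid_word_mulV w : braid_eq (w ++ braid_inv_word w) [::].
Proof.
elim: w => [|[i b] w IH]; first exact: braid_refl.
rewrite /braid_inv_word /= rev_cons -cats1 catA -/(braid_inv_word w).
apply: (@braid_trans _ _ ([:: (i, b)] ++ [::] ++ [:: (i, ~~ b)])).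
  apply: (@braid_cat _ [:: (i, b)] [:: (i, b)]); first exact: braid_refl.
  by apply: braid_cat IH _; exact: braid_refl.
exact: braid_cancel.
Qed.

Lemma braid_mulV : right_inverse braid_one braid_inv braid_mul.
Proof.
move=> x; rewrite -[in X in braid_mul X](braid_ofK x) braid_ofM.
by apply/braid_ofP/asboolP; exact: braid_word_mulV.
Qed.

Lemma braid_Vmul : left_inverse braid_one braid_inv braid_mul.
Proof.
move=> x; rewrite -[in X in braid_mul _ X](braid_ofK x) braid_ofM.
apply/braid_ofP/asboolP; rewrite -{2}(braid_word_invK (repr x)).
exact: braid_word_mulV.
Qed.

HB.instance Definition _ := isGroup.Build braid_group
  braid_mulA braid_mul1 braid_mulr1 braid_Vmul braid_mulV.

Definition braid_gen (i : 'I_m.-1) : braid_group := braid_of [:: (i, true)].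

End BraidGroup.

Section HermitianSpaces.
Variables (K : numClosedFieldType) (V : vectType K).

(* As G is a group, the maps rho a are automatically invertible. *)
Definition linear_action (G : groupType) (rho : G -> 'End(V)) : Prop :=
  rho 1%g = \1%VF /\ forall a b : G, rho (a * b)%g = (rho a \o rho b)%VF.

Definition hermitian_form := {hermitian V for false & (@Num.conj K)}.

Definition indefinite (h : hermitian_form) : Prop :=
  (exists v, 0 < h v v) /\ (exists v, h v v < 0).

Definition unitary_group (h : hermitian_form) : set 'End(V) :=
  [set g | lker g = 0%VS /\ isometry h h g].

Definition end_mx (g : 'End(V)) : 'M[K]_(\dim {:V}) :=
  passmx.mxof (vbasis fullv) (vbasis fullv) g.

(* Closure for the usual topology of the finite-dimensional space End(V), read off
   on matrices in a basis of V (any basis gives the same topology). *)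
Definition end_closure (S : set 'End(V)) : set 'End(V) :=
  [set g | closure (end_mx @` S) (end_mx g)].

End HermitianSpaces.

(* Main.v *)
(* At q = i the braiding of V0 with itself is zeta (1 + N), where zeta^2 = q, N^2 = 0 and q N is,
   up to sign, the Temperley-Lieb generator for the loop value q + q^-1 = 0. The braid relations
   therefore reduce to N_i N_j N_i = - N_i for adjacent i and j.

   On V0^(x)m the Hermitian form with matrix G = X (x) ... (x) X, X the matrix exchanging v_0 and
   v_1, makes E, F and K self-adjoint and each N_i skew, so each sigma_i is unitary. As G pairs the
   weights l and -l, the induced form on Hom(V0, V0^(x)m) is twice <f v_0, g v_1>. For f <> 0 with
   x = f v_0, pairing f with the morphism built from the weight -1 vector G x gives 2 |x|^2 > 0, so
   the form is nondegenerate. It is indefinite since N_0 f is isotropic, and N_0 <> 0 on the Hom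
   space: apply it to the morphism built from v_0 (x) v_1 (x) v_1 (x) v_0 (x) v_1 (x) ...

   The 8k-th powers zeta^8k (1 + 8k N_0) = 1 + 8k N_0 of sigma_0 are pairwise distinct, so the image
   is infinite. As 1 + N_i is unipotent and zeta^8 = 1, every element of the image has a determinant
   with 8-th power 1; this is a closed condition, violated by most scalars of modulus 1. *)
Require Import Defs.
From HB Require Import structures.
From mathcomp Require Import all_boot all_order all_algebra.
From mathcomp Require Import generic_quotient sesquilinear complex mxtens ring perm.
From mathcomp Require Import all_classical all_reals all_analysis.
Import Order.TTheory GRing.Theory Num.Theory.
Import numFieldNormedType.Exports.

Set Implicit Arguments.
Unset Strict Implicit.
Unset Printing Implicit Defensive.

Local Open Scope classical_set_scope.
Local Open Scope ring_scope.

(** * Kronecker products: associativity and signs *)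

Lemma mxtens_indexA m n p (i : 'I_m) (j : 'I_n) (l : 'I_p) :
  cast_ord (esym (mulnA m n p)) (mxtens_index (mxtens_index (i, j), l)) =
  mxtens_index (i, mxtens_index (j, l)).
Proof. by apply: val_inj => /=; rewrite mulnDl addnA mulnA. Qed.

Section TensorCalculus.
Variable A : comNzRingType.

Lemma tensmxNl m n p r (M : 'M[A]_(m, n)) (N : 'M[A]_(p, r)) :
  (- M) *t N = - (M *t N).
Proof. by rewrite -scaleN1r tensmxZl scaleN1r. Qed.

Lemma tensmxNr m n p r (M : 'M[A]_(m, n)) (N : 'M[A]_(p, r)) :
  M *t (- N) = - (M *t N).
Proof. by rewrite -scaleN1r tensmxZr scaleN1r. Qed.

(** The enumeration of index triples does not depend on the bracketing, by [mxtens_indexA]. This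
    removes the cast in [braid_at]. *)
Lemma castmx_tensA m n p m' n' p' (M : 'M[A]_(m, m')) (N : 'M[A]_(n, n'))
    (P : 'M[A]_(p, p')) :
  castmx (esym (mulnA _ _ _), esym (mulnA _ _ _)) ((M *t N) *t P) =
  M *t (N *t P).
Proof.
apply/matrixP=> i j; rewrite castmxE /= !esymK.
case: (mxtens_indexP i) => a b; case: (mxtens_indexP b) => c d {b}.
case: (mxtens_indexP j) => a' b; case: (mxtens_indexP b) => c' d' {b}.
by rewrite -!mxtens_indexA !cast_ordKV mxtens_indexA !mxtens_indexA !tensmxE mulrA.
Qed.

End TensorCalculus.

Definition tensmx_linE :=
  (tensmxDl, tensmxDr, tensmxZl, tensmxZr, tensmxNl, tensmxNr, tens0mx, tensmx0).

Ltac expand_tensors :=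
  rewrite ?tensmx_linE;
  do 2 rewrite ?(mulmxDl, mulmxDr, mulNmx, mulmxN) -?(scalemxAl, scalemxAr);
  rewrite ?tensmx_mul ?mul1mx ?mulmx1 ?mul1mx;
  rewrite ?mul_delta_mx_cond /= ?(mulr0n, mulr1n) ?tensmx_linE ?scaler0;
  rewrite ?(addr0, add0r, oppr0, opprK, scalerN, scalerA).

(** * Cups, caps and the Temperley-Lieb relations at loop value zero *)

Section CupCap.
Variables (k : fieldType) (q : k).
Hypothesis q2 : q * q = - 1.
Local Notation e00 := (delta_mx 0 0 : 'M[k]_2).
Local Notation e01 := (delta_mx 0 1 : 'M[k]_2).
Local Notation e10 := (delta_mx 1 0 : 'M[k]_2).
Local Notation e11 := (delta_mx 1 1 : 'M[k]_2).

Lemma mx2_1E : (1%:M : 'M[k]_2) = e00 + e11.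
Proof.
by apply/matrixP=> [[[|[|//]] ?]] [[|[|//]] ?]; rewrite !mxE /= ?addr0 ?add0r.
Qed.

Lemma mx1_1E : (1%:M : 'M[k]_1) = delta_mx 0 0.
Proof. by apply/matrixP=> i j; rewrite !mxE !ord1. Qed.

(** K, its inverse and H act on V0 by this matrix with c = q, - q and 1 respectively, so one
    computation serves all three. *)
Definition sgdiag (c : k) : 'M[k]_2 := c *: e00 - c *: e11.

Lemma sgdiag_units c :
  ((sgdiag c *m (delta_mx 0 0 : 'cV_2) = c *: delta_mx 0 0)
  * (sgdiag c *m (delta_mx 1 0 : 'cV_2) = - c *: delta_mx 1 0)
  * ((delta_mx 0 0 : 'rV_2) *m sgdiag c = c *: delta_mx 0 0)
  * ((delta_mx 0 1 : 'rV_2) *m sgdiag c = - c *: delta_mx 0 1))%type.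
Proof.
rewrite /sgdiag !mulmxBl !mulmxBr -!scalemxAl -!scalemxAr !mul_delta_mx_cond /=.
by rewrite !mulr0n !mulr1n !scaler0 !subr0 !sub0r !scaleNr.
Qed.

Lemma raise_units :
  ((e01 *m (delta_mx 0 0 : 'cV_2) = 0)
  * (e01 *m (delta_mx 1 0 : 'cV_2) = delta_mx 0 0)
  * ((delta_mx 0 0 : 'rV_2) *m e01 = delta_mx 0 1)
  * ((delta_mx 0 1 : 'rV_2) *m e01 = 0))%type.
Proof. by rewrite !mul_delta_mx_cond. Qed.

Lemma lower_units :
  ((e10 *m (delta_mx 0 0 : 'cV_2) = delta_mx 1 0)
  * (e10 *m (delta_mx 1 0 : 'cV_2) = 0)
  * ((delta_mx 0 0 : 'rV_2) *m e10 = 0)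
  * ((delta_mx 0 1 : 'rV_2) *m e10 = delta_mx 0 0))%type.
Proof. by rewrite !mul_delta_mx_cond. Qed.

(** Insertion of the invariant vector v_0 (x) v_1 + q v_1 (x) v_0 of V0 (x) V0. The factors 1 in the
    dimension keep the Kronecker shape, so that products with cups and caps are computed factor by
    factor without casts. *)
Definition cup m : 'M[k]_(2 * (2 * m), 1 * (1 * m)) :=
  (delta_mx 0 0 : 'cV_2) *t ((delta_mx 1 0 : 'cV_2) *t 1%:M)
  + q *: ((delta_mx 1 0 : 'cV_2) *t ((delta_mx 0 0 : 'cV_2) *t 1%:M)).

Definition cap m : 'M[k]_(1 * (1 * m), 2 * (2 * m)) :=
  (delta_mx 0 0 : 'rV_2) *t ((delta_mx 0 1 : 'rV_2) *t 1%:M)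
  + q *: ((delta_mx 0 1 : 'rV_2) *t ((delta_mx 0 0 : 'rV_2) *t 1%:M)).

(* The Temperley-Lieb generator with loop value q + q^-1 = 0, up to the factor that makes the
   braiding of V0 equal to zeta (1 + hook). *)
Definition hook m : 'M[k]_(2 * (2 * m)) := - (cup m *m cap m).

Lemma hookE m : hook m = e11 *t (e00 *t 1%:M) - e00 *t (e11 *t 1%:M)
  - q *: (e10 *t (e01 *t 1%:M) + e01 *t (e10 *t 1%:M)).
Proof.
rewrite /hook /cup /cap; expand_tensors.
by apply/matrixP=> i j; rewrite !mxE; ring: q2.
Qed.

(** The closed loop evaluates to 1 + q^2. *)
Lemma cap_cup m : cap m *m cup m = 0.
Proof.
rewrite /cup /cap; expand_tensors.
by apply/matrixP=> i j; rewrite !mxE; ring: q2.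
Qed.

Lemma hook_sqr m : hook m *m hook m = 0.
Proof.
by rewrite /hook mulmxN mulNmx opprK -mulmxA (mulmxA (cap m)) cap_cup mul0mx mulmx0.
Qed.

(** As [hook] factors through [cap] and [cup], it is enough that X passes through each of them,
    becoming the same Y on the smaller space. *)
Lemma hook_comm m (X : 'M[k]_(2 * (2 * m))) (Y : 'M[k]_(1 * (1 * m))) :
  X *m cup m = cup m *m Y -> cap m *m X = Y *m cap m ->
  hook m *m X = X *m hook m.
Proof.
by move=> Xu Xc; rewrite /hook mulNmx mulmxN mulmxA Xu -!mulmxA Xc.
Qed.

Lemma hook_tensC m (S : 'M[k]_m) :
  hook m *m (1%:M *t (1%:M *t S)) = (1%:M *t (1%:M *t S)) *m hook m.
Proof.
by apply: (hook_comm (Y := 1%:M *t (1%:M *t S))); rewrite /cup /cap; expand_tensors.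
Qed.


Ltac expand_acts units :=
  rewrite /cup /cap ?(mulmxDl, mulmxDr) -?(scalemxAl, scalemxAr) !tensmx_mul;
  rewrite ?(mul1mx, mulmx1) ?(units, sgdiag_units) ?tensmx_linE ?scalerA;
  apply/matrixP=> i j; rewrite !mxE; ring: q2.

(** Here X is the action of E on V0 (x) V0 (x) W. The cup spans a trivial submodule of V0 (x) V0, so
    Y is the action of E on W alone; the same pattern serves F and H. *)
Lemma hook_actE m (E K : 'M[k]_m) :
  let X := 1%:M *t (1%:M *t E + e01 *t K) + e01 *t (sgdiag q *t K) in
  hook m *m X = X *m hook m.
Proof.
by apply: (hook_comm (Y := 1%:M *t (1%:M *t E))); rewrite tensmxDr; expand_acts raise_units.
Qed.

Lemma hook_actF m (F : 'M[k]_m) :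
  let Ki := sgdiag (- q) in
  let X := Ki *t (Ki *t F + e10 *t 1%:M) + e10 *t (1%:M *t 1%:M) in
  hook m *m X = X *m hook m.
Proof.
by apply: (hook_comm (Y := 1%:M *t (1%:M *t F))); rewrite tensmxDr; expand_acts lower_units.
Qed.

(** With c = q or c = - q this covers K and its inverse, and the factor - c^2 of Y is then 1. *)
Lemma hook_actK m (K : 'M[k]_m) (c : k) :
  hook m *m (sgdiag c *t (sgdiag c *t K)) = (sgdiag c *t (sgdiag c *t K)) *m hook m.
Proof.
by apply: (hook_comm (Y := - c ^+ 2 *: (1%:M *t (1%:M *t K)))); expand_acts sgdiag_units.
Qed.

Lemma hook_actH m (H : 'M[k]_m) :
  let X := sgdiag 1 *t (1%:M *t 1%:M) + 1%:M *t (sgdiag 1 *t 1%:M + 1%:M *t H) in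
  hook m *m X = X *m hook m.
Proof.
by apply: (hook_comm (Y := 1%:M *t (1%:M *t H))); rewrite tensmxDr; expand_acts sgdiag_units.
Qed.

Lemma delta_mx_form (A : 'M[k]_2) i j :
  (delta_mx 0 i : 'rV_2) *m A *m (delta_mx j 0 : 'cV_2) = A i j *: 1%:M.
Proof.
by rewrite -rowE -colE; apply/matrixP=> a b; rewrite !mxE !ord1 mulr1.
Qed.

(** A loop carrying A on one strand and B on the other is a scalar; the products of hooks below are
    sums of such loops. *)
Lemma cap_slide m (A B : 'M[k]_2) (W : 'M[k]_m) :
  cap m *m (A *t (B *t W)) *m cup m =
  (A 0 0 * B 1 1 - A 1 1 * B 0 0 + q * (A 0 1 * B 1 0 + A 1 0 * B 0 1))
    *: (1%:M *t (1%:M *t W)).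
Proof.
rewrite /cup /cap !(mulmxDl, mulmxDr) -!(scalemxAl, scalemxAr) !tensmx_mul.
rewrite !(delta_mx_form, mul1mx, mulmx1) !tensmx_linE !scalerA -!scalerDl.
by congr (_ *: _); ring: q2.
Qed.

(** Straightening a zigzag. By [cap_slide] the two off-diagonal terms of [hookE] vanish, while the
    two diagonal ones leave the matrix units e00 and e11 on the third strand, which add up to the
    identity. *)
Lemma cap_hook_cup m :
  cap (2 * m) *m (1%:M *t hook m) *m cup (2 * m) = 1%:M.
Proof.
have := @cap_slide (2 * m); move: (cap _) (cup _) => c u slide.
rewrite hookE !tensmx_linE !(mulmxDl, mulmxDr, mulmxN, mulNmx).
do 2 rewrite ?(mulmxDl, mulmxDr, mulmxN, mulNmx) -?(scalemxAl, scalemxAr).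
rewrite !slide !mxE /=.
rewrite !(mulr0, mulr1, mul0r, addr0, subr0, sub0r, scale0r, scale1r, scaler0, scaleN1r, opprK).
by rewrite -!tensmxDr -tensmxDl -mx2_1E !tensmx11.
Qed.

Lemma cap_hook_cup' m :
  ((1%:M : 'M[k]_2) *t cap m) *m hook (2 * m) *m (1%:M *t cup m) = 1%:M.
Proof.
rewrite hookE; have := @cap_slide m; move: (cap _) (cup _) => c u slide.
rewrite -!(tensmx11 k 2 m) !(mulmxDl, mulmxDr, mulmxN, mulNmx).
do 2 rewrite ?(mulmxDl, mulmxDr, mulmxN, mulNmx) -?(scalemxAl, scalemxAr).
rewrite !tensmx_mul !(mul1mx, mulmx1).
rewrite !slide !mxE /=.
rewrite !(mulr0, mulr1, mul0r, addr0, subr0, sub0r, scale0r, scale1r, scaler0, scaleN1r, opprK).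
by rewrite !tensmx_linE addr0 scaler0 subr0 opprK addrC -tensmxDl -mx2_1E !tensmx11.
Qed.

Lemma hook_TL m :
  hook (2 * m) *m (1%:M *t hook m) *m hook (2 * m) = - hook (2 * m).
Proof.
rewrite {1 3}/hook !(mulNmx, mulmxN) -!mulmxA (mulmxA (_ *t _)) (mulmxA (cap _)).
by rewrite (mulmxA (cap _)) cap_hook_cup mul1mx.
Qed.

Lemma hook_TL' m :
  (1%:M *t hook m) *m hook (2 * m) *m (1%:M *t hook m) =
  - ((1%:M : 'M[k]_2) *t hook m).
Proof.
have -> : (1%:M : 'M[k]_2) *t hook m = - ((1%:M *t cup m) *m (1%:M *t cap m)).
  by rewrite tensmx_mul mul1mx tensmxNr.
have := cap_hook_cup' m; move: (hook (2 * m)) => h chc.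
rewrite !(mulNmx, mulmxN) -!mulmxA (mulmxA h) (mulmxA (_ *t cap _)).
by rewrite (mulmxA (_ *t cap _)) chc mul1mx opprK.
Qed.
End CupCap.

(** * The braiding of V0 in terms of hooks *)

Section BraidMatrices.
Variable R : realType.
Local Notation C := R[i].
Local Notation q := (qpow (1 : C)).
Local Notation V := (@V0 R).
Local Notation hook := (@hook C q).

(** The scalar by which q^(H (x) H / 2) acts on v_0 (x) v_0 and v_1 (x) v_1. *)
Definition zeta : C := qpow 2^-1.

Lemma qq : q * q = - 1 :> C.
Proof. by rewrite -expr2 q2E. Qed.

Lemma zeta2 : zeta * zeta = q.
Proof. by rewrite /zeta -qpowD -[1]/(1%:R : C); congr qpow; field. Qed.

(** The value of q^(H (x) H / 2) on the mixed tensors is also a multiple of zeta, which lets zeta be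
    factored out of the whole braiding. *)
Lemma zetaV : qpow (- 2^-1) = - q * zeta :> C.
Proof.
have -> : - q = qpow (- 1) by rewrite qpowN1E qpow1E.
by rewrite -qpowD; congr qpow; field.
Qed.

Lemma zeta8 : zeta ^+ 8 = 1.
Proof. by rewrite (exprM _ 2 4) expr2 zeta2 (exprM _ 2 2) q2E sqrrN expr1n. Qed.

Lemma actK_V0 : actK V = sgdiag q.
Proof.
apply/matrixP=> [[[|[|//]] ?]] [[|[|//]] ?]; rewrite !mxE /= ?expr0 ?expr1 ?qpowN1E ?qpow1E;
  by rewrite ?(mulr1n, mulr0n, mulr1, mulr0, subr0, sub0r).
Qed.

Lemma actKi_V0 : actKi V = sgdiag (- q).
Proof.
apply/matrixP=> [[[|[|//]] ?]] [[|[|//]] ?]; rewrite !mxE /= ?expr0 ?expr1 ?opprK ?qpowN1E ?qpow1E;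
  by rewrite ?(mulr1n, mulr0n, mulr1, mulr0, subr0, sub0r, opprK, oppr0).
Qed.

Lemma actH_V0 : actH V = sgdiag 1.
Proof.
apply/matrixP=> [[[|[|//]] ?]] [[|[|//]] ?]; rewrite !mxE /= ?expr0 ?expr1;
  by rewrite ?(mulr1n, mulr0n, mulr1, mulr0, subr0, sub0r, opprK, oppr0).
Qed.

Lemma flip_mulmx m n p (M : 'M[C]_(m * n, p)) (i : 'I_n) (j : 'I_m) l :
  (flip R m n *m M) (mxtens_index (i, j)) l = M (mxtens_index (j, i)) l.
Proof.
rewrite !mxE (bigD1 (mxtens_index (j, i))) //= big1 => [|a].
  by rewrite !mxE !mxtens_indexK eqxx mul1r addr0.
case: (mxtens_indexP a) => x y ne; rewrite !mxE !mxtens_indexK /=.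
case: eqP => [[ei ej]|]; last by rewrite mul0r.
by rewrite ei ej eqxx in ne.
Qed.

Lemma braiding_V0 : braiding V V = zeta *:
  (1%:M + (delta_mx 1 1 *t delta_mx 0 0 - delta_mx 0 0 *t delta_mx 1 1
    - q *: (delta_mx 1 0 *t delta_mx 0 1 + delta_mx 0 1 *t delta_mx 1 0))).
Proof.
apply/matrixP=> x y; rewrite /braiding.
case: (mxtens_indexP x) => a b; case: (mxtens_indexP y) => c d.
rewrite flip_mulmx /Rmx /qHH tensmx11 mul1mx invmx1 mulmx1 mul_diag_mx.
rewrite -(tensmx11 C 2 2) !mxE !mxtens_indexK /=.
have -> : qbrace (1 : C) = q + q by rewrite /qbrace qpowN1E qpow1E; rewrite opprK.
case: a => [[|[|//]] ?]; case: b => [[|[|//]] ?]; case: c => [[|[|//]] ?];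
  case: d => [[|[|//]] ?] /=; rewrite ?expr0 ?expr1;
  rewrite ?(mulr1n, mulr0n, mulr1, mulr0, mul1r, mul0r, mulrN1, mulN1r, subr0, sub0r, add0r, addr0, opprK, oppr0) //.
all: by rewrite ?zetaV -?/zeta; ring: qq.
Qed.

(** Follows the recursion of [braid_at]. No cast occurs, since [hook] is already bracketed to the
    right, and the default value is 0 so that all relations hold without bounds except
    [hook_at_TL]. *)
Fixpoint hook_at (m i : nat) : 'M[C]_(wdim (tpow V m)) :=
  match m, i with
  | m'.+2, 0 => hook (wdim (tpow V m'))
  | m'.+1, i'.+1 => 1%:M *t hook_at m' i'
  | _, _ => 0
  end.

Lemma braid_atE m i : (i.+1 < m)%N -> braid_at V m i = zeta *: (1%:M + hook_at m i).
Proof.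
elim: m i => [|[|m] IH] [|i] //= im; last first.
  by rewrite IH // tensmxZr tensmxDr tensmx11.
rewrite braiding_V0 tensmxZl.
have castZ a b a' b' (ea : a = a') (eb : b = b') (c : C) (M : 'M[C]_(a, b)) :
    castmx (ea, eb) (c *: M) = c *: castmx (ea, eb) M.
  by case: _ / ea; case: _ / eb; rewrite !castmx_id.
have castD a b a' b' (ea : a = a') (eb : b = b') (M N : 'M[C]_(a, b)) :
    castmx (ea, eb) (M + N) = castmx (ea, eb) M + castmx (ea, eb) N.
  by case: _ / ea; case: _ / eb; rewrite !castmx_id.
have castN a b a' b' (ea : a = a') (eb : b = b') (M : 'M[C]_(a, b)) :
    castmx (ea, eb) (- M) = - castmx (ea, eb) M.
  by case: _ / ea; case: _ / eb; rewrite !castmx_id.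
rewrite -(tensmx11 C 2 2) !(tensmxDl, tensmxZl, tensmxNl) !(castZ, castD, castN).
by rewrite !castmx_tensA !tensmx11 (hookE qq).
Qed.

(** Not a conversion for a variable m, because the match first looks for two successors. *)
Lemma hook_atS m i : hook_at m.+1 i.+1 = 1%:M *t hook_at m i.
Proof. by case: m. Qed.

Lemma hook_at_sqr m i : hook_at m i *m hook_at m i = 0.
Proof.
elim: m i => [|m IH] [|i]; rewrite ?hook_atS ?tensmx_mul ?IH ?mulmx0 ?tensmx0 //.
by case: m {IH} => [|m]; [exact: mulmx0 | exact: (hook_sqr qq)].
Qed.

Lemma hook_at_far m i j : (i.+1 < j)%N ->
  hook_at m i *m hook_at m j = hook_at m j *m hook_at m i.
Proof.
elim: m i j => [|m IH] [|i] [|[|j]] // ij; rewrite ?(mulmx0, mul0mx) //.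
  by case: m {IH} => [|m]; rewrite ?(mulmx0, mul0mx) // !hook_atS; exact: hook_tensC.
by rewrite !(hook_atS m) !tensmx_mul IH.
Qed.

Lemma hook_at_TL m i : (i.+2 < m)%N ->
  hook_at m i *m hook_at m i.+1 *m hook_at m i = - hook_at m i /\
  hook_at m i.+1 *m hook_at m i *m hook_at m i.+1 = - hook_at m i.+1.
Proof.
elim: m i => [|m IH] [|i] // im.
  case: m im {IH} => [|[|m]] // _.
  by split; [exact: (hook_TL qq) | exact: (hook_TL' qq)].
have [e1 e2] := IH i im.
by rewrite !(hook_atS m) !tensmx_mul e1 e2 !mul1mx !tensmxNr.
Qed.

Definition commutes_uq (W : wmod R) (f : 'M[C]_(wdim W)) : Prop :=
  [/\ f *m actE W = actE W *m f, f *m actF W = actF W *m f,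
      f *m actK W = actK W *m f, f *m actKi W = actKi W *m f
    & f *m actH W = actH W *m f].

Lemma hook_at_hom m i : commutes_uq (hook_at m i : 'M[C]_(wdim (tpow V m))).
Proof.
have h0 W : @commutes_uq W 0 by split; rewrite mulmx0 mul0mx.
elim: m i => [|[|m] IH] [|i]; [exact: h0| exact: h0|exact: h0| | |].
- by rewrite hook_atS (_ : hook_at 0 i = 0) ?tensmx0; [exact: h0 | case: i].
- move: actK_V0 actKi_V0 actH_V0; rewrite /commutes_uq /= => -> -> ->; split.
  + exact: (hook_actE qq).
  + by rewrite -(tensmx11 C 2 (wdim (tpow V m))); exact: (hook_actF qq).
  + exact: (hook_actK qq).
  + exact: (hook_actK qq).
  + by rewrite -(tensmx11 C 2 (wdim (tpow V m))); exact: (hook_actH qq).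
have [fE fF fK fKi fH] := IH i; rewrite /commutes_uq.
rewrite hook_atS.
rewrite -[tpow V m.+2]/(tens V (tpow V m.+1)).
(* The remaining case holds for 1 (x) f on V0 (x) W with any f commuting with the action on W.
   Generalizing keeps [tpow] from being unfolded. *)
move: fE fF fK fKi fH; move: (hook_at _ _) => f; move: (tpow V m.+1) f => W f.
move=> fE fF fK fKi fH.
rewrite /=; split.
- by rewrite mulmxDl mulmxDr !tensmx_mul fE fK !(mul1mx, mulmx1).
- by rewrite mulmxDl mulmxDr !tensmx_mul fF !(mul1mx, mulmx1).
- by rewrite !tensmx_mul fK !(mul1mx, mulmx1).
- by rewrite !tensmx_mul fKi !(mul1mx, mulmx1).
by rewrite mulmxDl mulmxDr !tensmx_mul fH !(mul1mx, mulmx1).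
Qed.

End BraidMatrices.

(** * The representation of the braid group *)

Section UnipotentMatrices.
Variables (k : comNzRingType) (d : nat).
Implicit Types a b : 'M[k]_d.

Lemma unipotentK a : a *m a = 0 -> (1%:M + a) *m (1%:M - a) = 1%:M.
Proof.
by move=> aa; rewrite mulmxDl !mulmxBr aa !mul1mx !mulmx1 subr0 subrK.
Qed.

Lemma unipotentVK a : a *m a = 0 -> (1%:M - a) *m (1%:M + a) = 1%:M.
Proof.
by move=> aa; rewrite mulmxDr !mulmxBl aa !mul1mx !mulmx1 subr0 subrK.
Qed.

Lemma unipotentC a b : a *m b = b *m a ->
  (1%:M + a) *m (1%:M + b) = (1%:M + b) *m (1%:M + a).
Proof.
by move=> ab; rewrite !mulmxDl !mulmxDr ab !mul1mx !mulmx1 addrACA.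
Qed.

(** Both sides expand to 1 + a + b + ab + ba, since aba cancels one of the two copies of a. *)
Lemma unipotent_braid a b : a *m a = 0 -> b *m b = 0 ->
    a *m b *m a = - a -> b *m a *m b = - b ->
  (1%:M + a) *m ((1%:M + b) *m (1%:M + a)) = (1%:M + b) *m ((1%:M + a) *m (1%:M + b)).
Proof.
move=> aa bb aba bab; rewrite !mulmxDl !mulmxDr !mul1mx !mulmx1 !mulmxA.
rewrite aa bb aba bab; move: (a *m b) (b *m a) => c e.
by apply/matrixP=> x y; rewrite !mxE; ring.
Qed.

End UnipotentMatrices.

Section BraidRepresentation.
Variable R : realType.
Local Notation C := R[i].
Local Notation V := (@V0 R).
Local Notation zeta := (zeta R).

Lemma zeta_neq0 : zeta != 0.
Proof.
apply/eqP=> z0; have := zeta8 R.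
by rewrite z0 expr0n /= => /eqP; rewrite eq_sym oner_eq0.
Qed.

Section Words.
Variable m : nat.
Local Notation d := (wdim (tpow V m)).

(** As hooks square to zero, the inverse of 1 + N is 1 - N; this gives an explicit matrix for
    inverse generators. *)
Definition letter_mx (x : 'I_m.-1 * bool) : 'M[C]_d :=
  if x.2 then zeta *: (1%:M + hook_at R m x.1)
  else zeta^-1 *: (1%:M - hook_at R m x.1).

Definition word_mx (w : braid_word m) : 'M[C]_d :=
  foldr (fun x M => letter_mx x *m M) 1%:M w.

Lemma word_mx_cat u v : word_mx (u ++ v) = word_mx u *m word_mx v.
Proof. by elim: u => [|x u IH] /=; rewrite ?mul1mx // IH mulmxA. Qed.

Lemma braid_eq_word_mx u v : braid_eq u v -> word_mx u = word_mx v.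
Proof.
elim=> {u v}.
- by [].
- by move=> u v _ ->.
- by move=> u v w _ -> _.
- by move=> u u' v v' _ eu _ ev; rewrite !word_mx_cat eu ev.
- move=> i b; rewrite /word_mx /letter_mx /= mulmx1; have := hook_at_sqr R m i.
  move: (hook_at R m i) => a aa; case: b; rewrite /= -scalemxAl -scalemxAr scalerA.
    by rewrite mulfV ?zeta_neq0 // scale1r unipotentK.
  by rewrite mulVf ?zeta_neq0 // scale1r unipotentVK.
- move=> i j ij; rewrite /word_mx /letter_mx /= !mulmx1; have := hook_at_far R m ij.
  move: (hook_at R m i) (hook_at R m j) => a b ab.
  by rewrite -!scalemxAl -!scalemxAr unipotentC.
(* The bound comes from j < m.-1; the case m = 0 has to be split off, but then j has no value. *)
move=> i j ij; have lt : (i.+2 < m)%N by rewrite -ij; case: (m) j {ij} => [|n] [].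
rewrite /word_mx /letter_mx /= !mulmx1.
have [] := hook_at_TL R lt; rewrite -ij.
move: (hook_at_sqr R m i) (hook_at_sqr R m j).
move: (hook_at R m i) (hook_at R m j) => a b aa bb aba bab.
by rewrite -!scalemxAl -!scalemxAr unipotent_braid.
Qed.

Lemma word_mx_hom w : commutes_uq (word_mx w : 'M[C]_(wdim (tpow V m))).
Proof.
(* Words are products of scalars times 1 + N or 1 - N, so commuting with every hook suffices. *)
have comm (X : 'M[C]_d) : (forall i, hook_at R m i *m X = X *m hook_at R m i) ->
    word_mx w *m X = X *m word_mx w.
  move=> hX; elim: w => [|[i b] w IH] /=; first by rewrite mul1mx mulmx1.
  rewrite -mulmxA IH !mulmxA; congr (_ *m _); rewrite /letter_mx /=.
  by case: b; rewrite -scalemxAl -scalemxAr mulmxDl mulmxDr ?(mulNmx, mulmxN) hX mul1mx mulmx1.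
by split; apply: comm => i; have [] := hook_at_hom R m i.
Qed.

End Words.

Section Action.
Variable n : nat.
Local Notation m := (n.*2.+1).
Local Notation T := (tpow V m).
Local Notation U := (module_hom V T).

Lemma commutes_uq_module_hom (f : 'M[C]_(wdim T)) g :
  commutes_uq f -> g \in U -> f *m g \in U.
Proof.
move=> [fE fF fK fKi fH] /module_homP[gE gF gK gKi gH]; apply/module_homP.
by split; rewrite -mulmxA ?(gE, gF, gK, gKi, gH) !mulmxA ?(fE, fF, fK, fKi, fH).
Qed.

(** [vsproj] only serves to land in the Hom space: the matrix of a word preserves that space, so
    nothing is lost ([word_endE]). *)
Definition word_end (w : braid_word m) : 'End(Hspace R n) :=
  linfun (vsproj U \o mulmx (word_mx w) \o vsval).

Lemma word_endE w f : vsval (word_end w f) = word_mx w *m vsval f.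
Proof.
rewrite lfunE /= vsprojK //; apply: commutes_uq_module_hom; last exact: subvsP.
exact: word_mx_hom.
Qed.

Definition braid_end (b : braid_group m) : 'End(Hspace R n) := word_end (repr b).

Lemma braid_end_of w : braid_end (braid_of w) = word_end w.
Proof.
apply/lfunP=> f; apply: val_inj; rewrite /= !word_endE.
by rewrite (braid_eq_word_mx (repr_braid_of w)).
Qed.

Lemma braid_end_action : linear_action braid_end.
Proof.
split=> [|a b]; apply/lfunP=> f; apply: val_inj; rewrite /=.
  by rewrite braid_end_of word_endE mul1mx id_lfunE.
by rewrite braid_end_of comp_lfunE !word_endE word_mx_cat mulmxA.
Qed.

Lemma braid_end_gen (i : 'I_m.-1) f :
  vsval (braid_end (braid_gen i) f) = braid_at V m i *m vsval f.
Proof.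
rewrite braid_end_of word_endE /= mulmx1 braid_atE //.
by case: i => i.
Qed.

End Action.
End BraidRepresentation.

(** * Adjoints and the invariant Hermitian form on tensor powers *)

Section Adjoint.
Variable C : numClosedFieldType.

Definition adjmx m n (M : 'M[C]_(m, n)) : 'M[C]_(n, m) := map_mx Num.conj M^T.

Lemma adjmxE m n (M : 'M[C]_(m, n)) i j : adjmx M i j = Num.conj (M j i).
Proof. by rewrite !mxE. Qed.

Lemma adjmxK m n : cancel (@adjmx m n) (@adjmx n m).
Proof. by move=> M; apply/matrixP=> i j; rewrite !adjmxE conjCK. Qed.

Lemma adjmxM m n p (M : 'M[C]_(m, n)) (N : 'M[C]_(n, p)) :
  adjmx (M *m N) = adjmx N *m adjmx M.
Proof. by rewrite /adjmx trmx_mul map_mxM. Qed.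

Lemma adjmx_tens m n p r (M : 'M[C]_(m, n)) (N : 'M[C]_(p, r)) :
  adjmx (M *t N) = adjmx M *t adjmx N.
Proof. by apply/matrixP=> i j; rewrite !mxE rmorphM. Qed.

Lemma adjmxD m n (M N : 'M[C]_(m, n)) : adjmx (M + N) = adjmx M + adjmx N.
Proof. by apply/matrixP=> i j; rewrite !mxE rmorphD. Qed.

Lemma adjmxN m n (M : 'M[C]_(m, n)) : adjmx (- M) = - adjmx M.
Proof. by apply/matrixP=> i j; rewrite !mxE rmorphN. Qed.

Lemma adjmxZ m n c (M : 'M[C]_(m, n)) : adjmx (c *: M) = Num.conj c *: adjmx M.
Proof. by apply/matrixP=> i j; rewrite !mxE rmorphM. Qed.

Lemma adjmx_delta m n i j : adjmx (delta_mx i j : 'M[C]_(m, n)) = delta_mx j i.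
Proof. by apply/matrixP=> a b; rewrite !mxE rmorph_nat andbC. Qed.

Lemma adjmx1 n : adjmx (1%:M : 'M[C]_n) = 1%:M.
Proof. by rewrite /adjmx trmx1 map_mx1. Qed.

Lemma mxtrace_adj n (M : 'M[C]_n) : \tr (adjmx M) = Num.conj (\tr M).
Proof. by rewrite /adjmx trace_map_mx mxtrace_tr. Qed.

Lemma adjmx_mul_eq0 n (x : 'cV[C]_n) : adjmx x *m x = 0 -> x = 0.
Proof.
move/matrixP/(_ 0 0); rewrite !mxE => /eqP; rewrite psumr_eq0 => [/allP x0|i _].
  apply/colP=> i; have := x0 i (mem_index_enum i).
  by rewrite adjmxE mulrC -normCK expf_eq0 /= normr_eq0 mxE => /eqP.
by rewrite adjmxE mulrC -normCK exprn_ge0.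
Qed.

End Adjoint.

Section SwapForm.
Variable C : numClosedFieldType.

Definition swap_mx : 'M[C]_2 := delta_mx 0 1 + delta_mx 1 0.

Lemma swap_units :
  ((swap_mx *m (delta_mx 0 0 : 'cV_2) = delta_mx 1 0)
  * (swap_mx *m (delta_mx 1 0 : 'cV_2) = delta_mx 0 0)
  * ((delta_mx 0 0 : 'rV_2) *m swap_mx = delta_mx 0 1)
  * ((delta_mx 0 1 : 'rV_2) *m swap_mx = delta_mx 0 0))%type.
Proof.
by rewrite /swap_mx !mulmxDl !mulmxDr !mul_delta_mx_cond /= !mulr1n !mulr0n !addr0 !add0r.
Qed.

Lemma adj_swap : adjmx swap_mx = swap_mx.
Proof. by rewrite /swap_mx adjmxD !adjmx_delta addrC. Qed.

Lemma swap_sqr : swap_mx *m swap_mx = 1%:M.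
Proof.
by rewrite /swap_mx !mulmxDl !mulmxDr !mul_delta_mx_cond /= !mulr1n !mulr0n addr0 add0r -mx2_1E.
Qed.

(** The matrices of E and F on V0 are adjoint to each other, so this and [swap_lower] state that
    both are self-adjoint for the form of [swap_mx]. *)
Lemma swap_raise : (delta_mx 1 0 : 'M[C]_2) *m swap_mx = swap_mx *m delta_mx 0 1.
Proof. by rewrite /swap_mx !mulmxDl !mulmxDr !mul_delta_mx_cond /= !mulr1n !mulr0n addr0 add0r. Qed.

Lemma swap_lower : (delta_mx 0 1 : 'M[C]_2) *m swap_mx = swap_mx *m delta_mx 1 0.
Proof. by rewrite /swap_mx !mulmxDl !mulmxDr !mul_delta_mx_cond /= !mulr1n !mulr0n addr0 add0r. Qed.

Lemma swap_sgdiag c : swap_mx *m sgdiag c = sgdiag (- c) *m swap_mx.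
Proof.
rewrite /swap_mx /sgdiag !mulmxDl !mulmxDr !mulmxN !mulNmx -!scalemxAl -!scalemxAr.
rewrite !mul_delta_mx_cond /= !mulr1n !mulr0n.
by rewrite !scaler0 !(oppr0, add0r, addr0) !scaleNr opprK addrC.
Qed.

Lemma adj_sgdiag (c : C) : adjmx (sgdiag c) = sgdiag (Num.conj c).
Proof. by rewrite /sgdiag adjmxD adjmxN !adjmxZ !adjmx_delta. Qed.

(** The form identifies the cup with q times the adjoint of the cap; this is what makes hooks
    skew. *)
Lemma pairing_cup (q : C) m (G : 'M[C]_m) : q * q = - 1 -> Num.conj q = - q ->
  (swap_mx *t (swap_mx *t G)) *m cup q m =
  q *: (adjmx (cap q m) *m (1%:M *t (1%:M *t G))).
Proof.
move=> q2 conj_q; rewrite /cup /cap adjmxD adjmxZ !adjmx_tens !adjmx_delta adjmx1 conj_q.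
rewrite mulmxDl mulmxDr -!(scalemxAl, scalemxAr) !tensmx_mul !swap_units !(mulmx1, mul1mx).
by apply/matrixP=> i j; rewrite !mxE; ring: q2.
Qed.

End SwapForm.

Section InvariantPairing.
Variable R : realType.
Local Notation C := R[i].
Local Notation V := (@V0 R).
Local Notation q := (qpow (1 : C)).
Local Notation zeta := (zeta R).
Local Notation swap_mx := (@swap_mx C).

Lemma conj_q : Num.conj q = - q.
Proof. by rewrite qpow1E complexiE conjCi. Qed.

Lemma norm_zeta : `|zeta| = 1.
Proof.
apply/eqP; rewrite -(@pexpr_eq1 _ _ 8) // -normrX zeta8 normr1 //.
Qed.

Lemma conj_zeta : Num.conj zeta * zeta = 1.
Proof. by rewrite mulrC -normCK norm_zeta expr1n. Qed.

Fixpoint pairing m : 'M[C]_(wdim (tpow V m)) :=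
  if m is m'.+1 then swap_mx *t pairing m' else 1%:M.

Lemma adj_pairing m : adjmx (pairing m) = pairing m.
Proof. by elim: m => [|m IH] /=; rewrite ?adjmx1 // adjmx_tens adj_swap IH. Qed.

Lemma pairing_sqr m : pairing m *m pairing m = 1%:M.
Proof.
by elim: m => [|m IH] /=; rewrite ?mulmx1 // tensmx_mul swap_sqr IH tensmx11.
Qed.

Section Adjointness.
Variable m : nat.
Local Notation T := (tpow V m).
Local Notation G := (pairing m).

(** Combined with [adj_K] this makes K self-adjoint for G, as the coproduct of E requires in
    [pairing_E]. *)
Lemma pairing_KKi : G *m actK T = actKi T *m G /\ G *m actKi T = actK T *m G.
Proof.
elim: m => [|n [IH1 IH2]]; first by rewrite /= mulmx1.
move: (actK_V0 R) (actKi_V0 R); rewrite /= => -> ->.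
split; first by rewrite !tensmx_mul IH1 swap_sgdiag.
by rewrite !tensmx_mul IH2 swap_sgdiag opprK.
Qed.

Lemma adj_K : adjmx (actK T) = actKi T /\ adjmx (actKi T) = actK T.
Proof.
elim: m => [|n [IH1 IH2]]; first by rewrite /= adjmx1.
move: (actK_V0 R) (actKi_V0 R); rewrite /= => -> ->.
split; first by rewrite adjmx_tens IH1 adj_sgdiag conj_q.
by rewrite adjmx_tens IH2 adj_sgdiag rmorphN /= conj_q opprK.
Qed.

Lemma pairing_H : G *m actH T = - (actH T *m G).
Proof.
elim: m => [|n IH]; first by rewrite /= mulmx0 mul0mx oppr0.
move: (actH_V0 R); rewrite /= => ->.
rewrite mulmxDl mulmxDr !tensmx_mul IH swap_sgdiag !mulmx1 !mul1mx tensmxNr opprD.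
congr (_ + _); rewrite -tensmxNl; congr (_ *t _).
by rewrite /sgdiag -mulNmx; congr (_ *m _); rewrite !scaleNr opprD.
Qed.

End Adjointness.

Lemma pairing_E m : adjmx (actE (tpow V m)) *m pairing m = pairing m *m actE (tpow V m).
Proof.
elim: m => [|m IH]; first by rewrite /= mulmx0 /adjmx trmx0 map_mx0 mul0mx.
have [KK _] := pairing_KKi m; have [aK _] := adj_K m.
rewrite /= adjmxD !adjmx_tens adjmx1 adjmx_delta mulmxDl mulmxDr !tensmx_mul.
by rewrite IH aK KK swap_raise !mulmx1 !mul1mx.
Qed.

Lemma pairing_F m : adjmx (actF (tpow V m)) *m pairing m = pairing m *m actF (tpow V m).
Proof.
elim: m => [|m IH]; first by rewrite /= mulmx0 /adjmx trmx0 map_mx0 mul0mx.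
move: (actKi_V0 R); rewrite /= => ->.
rewrite /= adjmxD !adjmx_tens adjmx1 adjmx_delta mulmxDl mulmxDr !tensmx_mul.
by rewrite IH swap_lower swap_sgdiag adj_sgdiag rmorphN /= conj_q !mulmx1 !mul1mx.
Qed.

Lemma pairing_hook_at m i :
  adjmx (hook_at R m i) *m pairing m = - (pairing m *m hook_at R m i).
Proof.
have a0 n : adjmx (0 : 'M[C]_n) = 0 by rewrite /adjmx trmx0 map_mx0.
elim: m i => [|m IH] [|i].
- by rewrite a0 mulmx0 mul0mx oppr0.
- by rewrite a0 mulmx0 mul0mx oppr0.
- case: m {IH} => [|m]; first by rewrite a0 mulmx0 mul0mx oppr0.
  (* The adjoint of e carries conj q = - q where e carries q. Using one after the other moves the
     hook across G, and this difference of sign gives skewness. *)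
  have e := pairing_cup (pairing m) (qq R) conj_q; have := congr1 (@adjmx _ _ _) e.
  rewrite adjmxZ !adjmxM !adjmx_tens adj_swap adj_pairing adjmxK !adjmx1 conj_q => e'.
  rewrite /= /hook adjmxN adjmxM mulNmx mulmxN -mulmxA e' mulmxA e.
  by rewrite -!(scalemxAl, scalemxAr) mulmxA scaleNr opprK.
rewrite !hook_atS /= adjmx_tens adjmx1 !tensmx_mul IH mul1mx mulmx1 tensmxNr.
by [].
Qed.

(** For one letter, skewness turns the adjoint of 1 + N into 1 - N on the other side of G, which
    cancels 1 + N, and zeta has modulus 1. *)
Lemma word_mx_unitary m (w : braid_word m) :
  adjmx (word_mx R w) *m pairing m *m word_mx R w = pairing m.
Proof.
elim: w => [|[i b] w IH] /=; first by rewrite adjmx1 mul1mx mulmx1.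
rewrite adjmxM -[RHS]IH !mulmxA; congr (_ *m _); rewrite -!mulmxA; congr (_ *m _).
rewrite /letter_mx /=; have := pairing_hook_at m i; have := hook_at_sqr R m i.
move: (hook_at R m i) => a aa aG.
have zV : Num.conj zeta^-1 * zeta^-1 = 1 by rewrite fmorphV -invfM conj_zeta invr1.
case: b; rewrite adjmxZ -!(scalemxAl, scalemxAr) scalerA ?conj_zeta ?zV scale1r
  adjmxD ?adjmxN adjmx1 mulmxA mulmxDl ?mulNmx aG mul1mx.
  by rewrite -{1}[pairing m]mulmx1 -mulmxBr -mulmxA unipotentVK // mulmx1.
by rewrite opprK -{1}[pairing m]mulmx1 -mulmxDr -mulmxA unipotentK // mulmx1.
Qed.

End InvariantPairing.

(** * Morphisms out of V0 and the form on them *)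

Section HomsFromV0.
Variable R : realType.
Local Notation C := R[i].
Local Notation V := (@V0 R).
Local Notation q := (qpow (1 : C)).
Local Notation e0 := (delta_mx 0 0 : 'cV[C]_2).
Local Notation e1 := (delta_mx 1 0 : 'cV[C]_2).
Local Notation r0 := (delta_mx 0 0 : 'rV[C]_2).
Local Notation r1 := (delta_mx 0 1 : 'rV[C]_2).

(* A vector z of weight -1 gives the highest weight vector E z of weight 1, hence the morphism
   v_0 |-> E z, v_1 |-> F E z. *)
Definition hom_of (W : wmod R) (z : 'cV[C]_(wdim W)) : 'M[C]_(wdim W, wdim V) :=
  (actE W *m z) *m r0 + (actF W *m (actE W *m z)) *m r1.

Lemma q_neq0 : q != 0.
Proof. by rewrite qpow1E complexiE neq0Ci. Qed.

Lemma uqEF_scalar : (q - q^-1)^-1 * (q + q) = 1.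
Proof.
have qV : q^-1 = - q by apply: (mulfI q_neq0); rewrite divff ?q_neq0 // mulrN qq opprK.
rewrite qV opprK mulVf // -mulr2n -mulr_natr mulf_neq0 ?q_neq0 //.
Qed.

(** Since q^2 = -1, both E and F anticommute with K, so M stands for either. *)
Lemma weight_shift d (K Ki M : 'M[C]_d) (x : 'cV[C]_d) (c : C) :
  K *m M *m Ki = - M -> Ki *m K = 1%:M -> K *m x = c *: x -> Ki *m x = - c *: x ->
  K *m (M *m x) = - c *: (M *m x) /\ Ki *m (M *m x) = c *: (M *m x).
Proof.
move=> KM KiK Kx Kix; split.
  rewrite -[x in LHS]mul1mx -KiK -(mulmxA Ki) Kx -!scalemxAr !mulmxA KM.
  by rewrite mulNmx scalerN scaleNr.
rewrite -[M in LHS]opprK -KM mulNmx mulmxN !mulmxA KiK mul1mx -!mulmxA Kix.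
by rewrite -scalemxAr scaleNr opprK.
Qed.

Section HomOf.
Variables (W : wmod R) (z : 'cV[C]_(wdim W)).
Local Notation E := (actE W).
Local Notation F := (actF W).
Local Notation K := (actK W).
Local Notation Ki := (actKi W).
Local Notation H := (actH W).
Hypotheses (Kz : K *m z = - q *: z) (Kiz : Ki *m z = q *: z) (Hz : H *m z = - z).

Lemma EF_weight (x : 'cV[C]_(wdim W)) c : K *m x = (c * q) *: x -> Ki *m x = - (c * q) *: x ->
  E *m (F *m x) - F *m (E *m x) = c *: x.
Proof.
move=> Kx Kix; rewrite !mulmxA -mulmxBl (uqEF (wmod_rel W)) -scalemxAl mulmxBl Kx Kix.
by rewrite -scalerBl scalerA opprK -mulrDr mulrCA uqEF_scalar mulr1.
Qed.

Lemma KE_anti : K *m E *m Ki = - E.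
Proof. by rewrite (uqKE (wmod_rel W)) q2E scaleN1r. Qed.

Lemma KF_anti : K *m F *m Ki = - F.
Proof. by rewrite (uqKF (wmod_rel W)) q2E invrN1 scaleN1r. Qed.

Lemma hom_of_module_hom : hom_of z \in module_hom V W.
Proof.
have KiK := uqKiK (wmod_rel W).
have [KEz KiEz] : K *m (E *m z) = q *: (E *m z) /\ Ki *m (E *m z) = - q *: (E *m z).
  have Kiz' : Ki *m z = - - q *: z by rewrite opprK.
  by have [-> ->] := weight_shift KE_anti KiK Kz Kiz'; rewrite opprK.
have [KFEz KiFEz] := weight_shift KF_anti KiK KEz KiEz.
have HEz : H *m (E *m z) = E *m z.
  have := uqHE (wmod_rel W) => /(congr1 (mulmx^~ z)); rewrite mulmxBl -!mulmxA Hz mulmxN opprK.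
  by rewrite -scalemxAl scaler_nat mulr2n => /addIr.
have HFEz : H *m (F *m (E *m z)) = - (F *m (E *m z)).
  have := uqHF (wmod_rel W) => /(congr1 (mulmx^~ (E *m z))); rewrite mulmxBl -!mulmxA HEz.
  by rewrite -scalemxAl scaleNr scaler_nat mulr2n opprD => /(canRL (subrK _)) ->; rewrite subrK.
have EEz : E *m (E *m z) = 0 by rewrite mulmxA (uqEE (wmod_rel W)) mul0mx.
have FFEz : F *m (F *m (E *m z)) = 0 by rewrite mulmxA (uqFF (wmod_rel W)) mul0mx.
(* E z is a highest weight vector of weight 1, on which EF acts by the quantum integer [1] = 1. *)
have EFEz : E *m (F *m (E *m z)) = E *m z.
  have := @EF_weight (E *m z) 1; rewrite !mul1r EEz mulmx0 subr0 scale1r; exact.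
(* F E z gets a name before E z is generalized, so that only the relations between these two vectors
   remain. *)
have [y Fx] : exists y, F *m (E *m z) = y by exists (F *m (E *m z)).
rewrite /hom_of Fx; rewrite Fx in KFEz KiFEz HFEz FFEz EFEz.
move: (E *m z) KEz KiEz KFEz KiFEz HEz HFEz EEz FFEz EFEz Fx.
move=> x Kx Kix Ky Kiy Hx Hy Ex Fy Ey Fx; apply/module_homP.
rewrite actK_V0 actKi_V0 actH_V0.
have sgd c : (x *m r0 + y *m r1) *m sgdiag c = c *: (x *m r0) - c *: (y *m r1).
  by rewrite mulmxDl -!mulmxA !sgdiag_units -!scalemxAr scaleNr.
split; rewrite ?sgd.
- by rewrite mulmxDl mulmxDr -!mulmxA !raise_units !mulmxA Ex Ey mul0mx mulmx0 addr0 add0r.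
- by rewrite mulmxDl mulmxDr -!mulmxA !lower_units !mulmxA Fx Fy mul0mx mulmx0 addr0 add0r.
- by rewrite mulmxDr !mulmxA Kx Ky -!scalemxAl scaleNr.
- by rewrite mulmxDr !mulmxA Kix Kiy -!scalemxAl !scaleNr opprK.
by rewrite mulmxDr !mulmxA Hx Hy mulNmx !scale1r.
Qed.

End HomOf.

Lemma module_hom_V0 (W : wmod R) (f : 'M[C]_(wdim W, wdim V)) (x := f *m e0) :
  f \in module_hom V W ->
  [/\ f *m e1 = actF W *m x, actE W *m x = 0, actK W *m x = q *: x,
      actKi W *m x = - q *: x & actH W *m x = x].
Proof.
case/module_homP; rewrite actK_V0 actKi_V0 actH_V0 => fE fF fK fKi fH.
have sg c : sgdiag c *m e0 = c *: e0 := (sgdiag_units c).1.1.1.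
have Fe0 : delta_mx 1 0 *m e0 = e1 := (lower_units C).1.1.1.
have Ee0 : delta_mx 0 1 *m e0 = 0 := (raise_units C).1.1.1.
split; rewrite /x mulmxA.
- by rewrite -fF -mulmxA Fe0.
- by rewrite -fE -mulmxA Ee0 mulmx0.
- by rewrite -fK -mulmxA sg -scalemxAr.
- by rewrite -fKi -mulmxA sg -scalemxAr.
by rewrite -fH -mulmxA sg scale1r.
Qed.

(** V0 is generated by v_0, as v_1 = F v_0. *)
Lemma module_hom_V0_eq0 (W : wmod R) (f : 'M[C]_(wdim W, wdim V)) :
  f \in module_hom V W -> f *m e0 = 0 -> f = 0.
Proof.
move=> /module_hom_V0[fe1 _ _ _ _] fe0; rewrite -[f]mulmx1 (mx2_1E C).
by rewrite -(mul_delta_mx (0 : 'I_1)) -(mul_delta_mx (0 : 'I_1) 1) mulmxDr !mulmxA fe1 fe0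
  mulmx0 !mul0mx addr0.
Qed.

(* f and g pair weight 1 with weight -1, so the matrix g^* G f of the pairing of f and g is
   antidiagonal; its two entries agree because F is G-self-adjoint. *)
Definition hom_form m (f g : 'M[C]_(wdim (tpow V m), 2)) : C :=
  \tr (@swap_mx C *m (adjmx g *m (pairing R m *m f))).

Lemma hom_form_sym m f g : @hom_form m f g = Num.conj (hom_form g f).
Proof.
rewrite /hom_form -mxtrace_adj !adjmxM adjmxK adj_pairing adj_swap mxtrace_mulC.
by rewrite !mulmxA.
Qed.

Lemma hom_form_linearl m g : GRing.linear_for *%R (@hom_form m ^~ g).
Proof.
move=> c f f'; rewrite /hom_form !mulmxDr -!scalemxAr mxtraceD mxtraceZ.
by [].
Qed.

Lemma hom_form_linearr m f : GRing.linear_for (Num.conj \; *%R) (@hom_form m f).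
Proof.
move=> c g g'; rewrite /hom_form; move: (@swap_mx C) => X; rewrite adjmxD adjmxZ mulmxDl mulmxDr -!scalemxAl -scalemxAr.
by rewrite mxtraceD mxtraceZ.
Qed.

(** The two antidiagonal entries pair F E z with x and E z with F x. Self-adjointness of E and F
    turns each into the pairing of z with E F x, and E F x = x. *)
Lemma hom_form_hom_of m (f : 'M[C]_(wdim (tpow V m), wdim V)) (z : 'cV[C]_(wdim (tpow V m)))
    (x := f *m e0) : f \in module_hom V (tpow V m) ->
  hom_form f (hom_of z) = (adjmx z *m (pairing R m *m x)) 0 0 *+ 2.
Proof.
move=> /module_hom_V0[]; rewrite -/x; set T := tpow V m; set G := pairing R m.
move=> fe1 Ex Kx Kix Hx.
have EFx : actE T *m (actF T *m x) = x.
  by have := @EF_weight T x 1; rewrite !mul1r Ex mulmx0 subr0 scale1r; exact.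
have trX (A : 'M[C]_2) : \tr (@swap_mx C *m A) = (r1 *m A *m e0 + r0 *m A *m e1) 0 0.
  rewrite /swap_mx mulmxDl mxtraceD -(mul_delta_mx (0 : 'I_1)).
  rewrite -(mul_delta_mx (0 : 'I_1) 1 0) -!mulmxA ![\tr (_ *m (_ *m A))]mxtrace_mulC.
  by rewrite /mxtrace !big_ord1 [in RHS]mxE !mulmxA.
rewrite /hom_form trX -!mulmxA fe1 !(mulmxA r1) !(mulmxA r0).
rewrite -[r0](adjmx_delta C 0 0) -[r1](adjmx_delta C 1 0) -!adjmxM /hom_of.
rewrite !mulmxDl -!mulmxA !mul_delta_mx_cond /= !mulr0n !mulr1n !mulmx0 add0r addr0.
rewrite (_ : delta_mx 0 0 = 1%:M :> 'M[C]_1) ?mulmx1; last first.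
  by apply/matrixP=> i j; rewrite !mxE !ord1.
rewrite !adjmxM -!mulmxA (mulmxA (adjmx (actF T))) pairing_F -!mulmxA.
by rewrite (mulmxA (adjmx (actE T))) pairing_E -mulmxA EFx mulr2n mxE.
Qed.

Lemma hom_form_unitary m f g (w : braid_word m) :
  hom_form (word_mx R w *m f) (word_mx R w *m g) = hom_form f g.
Proof.
rewrite /hom_form adjmxM -!mulmxA (mulmxA (pairing R m)) (mulmxA (adjmx (word_mx _ _))).
by rewrite (mulmxA (adjmx (word_mx _ _))) word_mx_unitary.
Qed.

(** Skewness brings the two hooks together, and N^2 = 0. *)
Lemma hom_form_hook m i f : hom_form (hook_at R m i *m f) (hook_at R m i *m f) = 0.
Proof.
rewrite /hom_form adjmxM -!mulmxA (mulmxA (adjmx (hook_at _ _ _))) pairing_hook_at.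
rewrite mulNmx -mulmxA (mulmxA (hook_at _ _ _)) hook_at_sqr mul0mx mulmx0 oppr0.
by rewrite !mulmx0 linear0.
Qed.

Lemma hom_form_nondegenerate m (f : 'M[C]_(wdim (tpow V m), wdim V)) :
  f \in module_hom V (tpow V m) ->
  (forall g, g \in module_hom V (tpow V m) -> hom_form f g = 0) -> f = 0.
Proof.
move=> fhom f_orth; have [_ _ Kx Kix Hx] := module_hom_V0 fhom.
apply: (module_hom_V0_eq0 fhom); apply: adjmx_mul_eq0.
set x := f *m e0 in Kx Kix Hx *; set z := pairing R m *m x.
have [GK GKi] := pairing_KKi R m.
have zhom : hom_of z \in module_hom V (tpow V m).
  apply: hom_of_module_hom; rewrite /z mulmxA -?GK -?GKi.
  - by rewrite -mulmxA Kix -scalemxAr.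
  - by rewrite -mulmxA Kx -scalemxAr.
  by rewrite -[_ *m pairing R m]opprK -pairing_H mulNmx -mulmxA Hx.
have /eqP := f_orth _ zhom; rewrite (hom_form_hom_of _ fhom) -mulr_natr mulf_eq0.
rewrite pnatr_eq0 orbF /z adjmxM adj_pairing -mulmxA
  [pairing R m *m (pairing R m *m x)]mulmxA pairing_sqr mul1mx.
by move=> /eqP x0; apply/matrixP=> i j; rewrite !ord1 x0 mxE.
Qed.

End HomsFromV0.

(** * The first hook acts nontrivially on the Hom space *)

Section NonvanishingHook.
Variables (k : fieldType) (q : k).
Hypothesis q2 : q * q = - 1.
Local Notation e0 := (delta_mx 0 0 : 'cV[k]_2).
Local Notation e1 := (delta_mx 1 0 : 'cV[k]_2).
Local Notation r0 := (delta_mx 0 0 : 'rV[k]_2).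
Local Notation r1 := (delta_mx 0 1 : 'rV[k]_2).

Lemma hook_highest m (y : 'cV[k]_m) :
  hook q m *m (e0 *t (e1 *t y)) = - (e0 *t (e1 *t y)) - q *: (e1 *t (e0 *t y)).
Proof.
rewrite (hookE q2) !(mulmxDl, mulNmx) -!scalemxAl !mulmxDl !tensmx_mul !mul1mx.
rewrite !mul_delta_mx_cond /= !mulr0n !mulr1n !(tens0mx, tensmx0).
by rewrite add0r addr0.
Qed.

(** EE is the action of E on three copies of V0 followed by another module. The coefficient along
    v_0 (x) v_1 (x) v_0 (x) w, read off by r, is -1: it arises only by raising the third letter in
    the term - v_0 (x) v_1 (x) v_1 (x) w of [hook_highest]. *)
Lemma raise_hook_neq0 m (E K : 'M[k]_m) (w : 'cV[k]_m) (r : 'rV[k]_m) :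
  let D := sgdiag q in
  let e01 := delta_mx 0 1 : 'M[k]_2 in
  let EE := 1%:M *t (1%:M *t (1%:M *t E + e01 *t K) + e01 *t (D *t K)) + e01 *t (D *t (D *t K)) in
  K *m w = w -> r *m w = 1%:M ->
  EE *m (hook q (2 * m) *m (e0 *t (e1 *t (e1 *t w)))) != 0.
Proof.
move=> D e01 EE Kw rw.
suff : (r0 *t (r1 *t (r0 *t r))) *m (EE *m (hook q (2 * m) *m (e0 *t (e1 *t (e1 *t w))))) = -1%:M.
  move=> e; apply/eqP=> e0'; move: e; rewrite e0' mulmx0 => /matrixP/(_ 0 0).
  by rewrite !mxE eqxx => /eqP; rewrite eq_sym oppr_eq0 oner_eq0.
have r1e : r1 *m e01 = 0 by exact: (raise_units k).2.
have r0e : r0 *m e01 = r1 by exact: (raise_units k).1.2.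
have r1D : r1 *m D = - q *: r1 by exact: (sgdiag_units q).2.
have rE (i j : 'I_2) : (delta_mx 0 i : 'rV[k]_2) *m (delta_mx j 0 : 'cV[k]_2) = (i == j)%:R%:M.
  rewrite mul_delta_mx_cond; apply/matrixP=> a b; rewrite !mxE !ord1 /=.
  by case: (i == j); rewrite !mxE.
rewrite hook_highest mulmxA {}/EE; clearbody D e01.
rewrite !(mulmxDr, tensmx_mul, mulmx1, r1e, r0e, r1D, tens0mx, tensmx0, addr0).
rewrite !(mulmxDl, mulmxDr, tensmx_mul, mulmxN, tensmxZl, tensmxZr).
rewrite -!(scalemxAl, scalemxAr) !tensmx_mul !rE /=.
rewrite -!mulmxA Kw rw !raddf0 !(tens0mx, tensmx0) !scaler0 !(oppr0, addr0, add0r).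
by rewrite !tensmx11.
Qed.

Lemma sgdiag_e0 (c : k) : sgdiag c *m e0 = c *: e0.
Proof. exact: (sgdiag_units c).1.1.1. Qed.

Lemma sgdiag_e1 (c : k) : sgdiag c *m e1 = - c *: e1.
Proof. exact: (sgdiag_units c).1.1.2. Qed.

Lemma sgdiag_tens_alternating (c : k) m (M : 'M[k]_m) (w : 'cV[k]_m) :
  (sgdiag c *t (sgdiag c *t M)) *m (e0 *t (e1 *t w)) = - (c * c) *: (e0 *t (e1 *t (M *m w))).
Proof.
rewrite !tensmx_mul sgdiag_e0 sgdiag_e1 !(tensmxZl, tensmxZr) scalerA.
by rewrite mulrN.
Qed.

Lemma sgdiag1_tens_alternating m (M : 'M[k]_m) (w : 'cV[k]_m) :
  (sgdiag 1 *t 1%:M + 1%:M *t (sgdiag 1 *t 1%:M + 1%:M *t M)) *m (e0 *t (e1 *t w)) =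
  e0 *t (e1 *t (M *m w)).
Proof.
rewrite mulmxDl !tensmx_mul sgdiag_e0 !mul1mx mulmxDl !tensmx_mul !mul1mx sgdiag_e1.
by rewrite scale1r scaleN1r tensmxDr tensmxNl tensmxNr addrA addrN add0r.
Qed.

Lemma sgdiag_tens_e1 (c : k) m (M : 'M[k]_m) (w : 'cV[k]_m) :
  (sgdiag c *t M) *m (e1 *t w) = - c *: (e1 *t (M *m w)).
Proof. by rewrite tensmx_mul sgdiag_e1 tensmxZl. Qed.

Lemma sgdiag1_tens_e1 m (M : 'M[k]_m) (w : 'cV[k]_m) :
  (sgdiag 1 *t 1%:M + 1%:M *t M) *m (e1 *t w) = e1 *t (M *m w) - e1 *t w.
Proof.
by rewrite mulmxDl !tensmx_mul !mul1mx sgdiag_e1 scaleN1r tensmxNl addrC.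
Qed.

Lemma alternating_normed m (w : 'cV[k]_m) :
  w^T *m w = 1%:M -> (e0 *t (e1 *t w))^T *m (e0 *t (e1 *t w)) = 1%:M.
Proof.
by move=> ww; rewrite !trmx_tens !tensmx_mul ww !trmx_delta !mul_delta_mx -!mx1_1E !tensmx11.
Qed.

End NonvanishingHook.

Section HookOnHoms.
Variable R : realType.
Local Notation C := R[i].
Local Notation V := (@V0 R).
Local Notation q := (qpow (1 : C)).
Local Notation e0 := (delta_mx 0 0 : 'cV[C]_2).
Local Notation e1 := (delta_mx 1 0 : 'cV[C]_2).

(** A weight 0 vector filling the last tensor positions, normalized so that its transpose is the
    functional r of [raise_hook_neq0]. *)
Fixpoint alternating_vec k : 'cV[C]_(wdim (tpow V k.*2)) :=
  if k is k'.+1 then e0 *t (e1 *t alternating_vec k') else 1%:M.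

Lemma alternating_vec_weight k (T := tpow V k.*2) (w := alternating_vec k) :
  [/\ actK T *m w = w, actKi T *m w = w, actH T *m w = 0 & w^T *m w = 1%:M].
Proof.
rewrite /T /w {T w}; elim: k => [|k [IHK IHKi IHH IHw]].
  by rewrite /= !mulmx1 trmx1; split; rewrite // mul0mx.
rewrite [alternating_vec _]/= -[tpow V k.+1.*2]/(tens V (tens V (tpow V k.*2))) /=.
move: (actK_V0 R) (actKi_V0 R) (actH_V0 R); rewrite /= => -> -> ->.
split.
- by rewrite sgdiag_tens_alternating IHK qq opprK scale1r.
- by rewrite sgdiag_tens_alternating IHKi mulrNN qq opprK scale1r.
- by rewrite sgdiag1_tens_alternating IHH !tensmx0.
exact: alternating_normed.
Qed.

Lemma hook_module_hom_neq0 n : (0 < n)%N ->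
  exists2 f, f \in module_hom V (tpow V n.*2.+1) & hook_at R n.*2.+1 0 *m f != 0.
Proof.
case: n => // k _; have [Kw Kiw Hw ww] := alternating_vec_weight k.
set T := tpow V _; set w := alternating_vec k in Kw Kiw Hw ww.
(* The total weight is 1 - 1 - 1 + 0 = -1, as [hom_of] requires. *)
pose z : 'cV[C]_(wdim T) := e0 *t (e1 *t (e1 *t w)).
exists (hom_of z).
  apply: hom_of_module_hom; rewrite /z.
  - move: (actK_V0 R); rewrite /= => ->.
    by rewrite sgdiag_tens_alternating sgdiag_tens_e1 Kw qq opprK scale1r !tensmxZr.
  - move: (actKi_V0 R); rewrite /= => ->.
    by rewrite sgdiag_tens_alternating sgdiag_tens_e1 Kiw mulrNN qq !opprK scale1r !tensmxZr.
  - move: (actH_V0 R); rewrite /= => ->.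
    by rewrite sgdiag1_tens_alternating sgdiag1_tens_e1 Hw tensmx0 sub0r !tensmxNr.
apply/eqP=> /(congr1 (mulmx^~ e0)); rewrite mul0mx -mulmxA.
have -> : hom_of z *m e0 = actE T *m z.
  rewrite /hom_of mulmxDl -!(mulmxA _ _ e0) !mul_delta_mx_cond /= mulr0n mulr1n mulmx0 addr0.
  by rewrite -mx1_1E mulmx1.
(* The hook commutes with E, so the image of v_0 is E N_0 z. *)
have [hE _ _ _ _] := hook_at_hom R k.+1.*2.+1 0.
rewrite mulmxA hE -mulmxA => /eqP; apply/negP.
have := raise_hook_neq0 (qq R) (actE (tpow V k.*2)) Kw ww.
by rewrite -(actK_V0 R).
Qed.

End HookOnHoms.

(** * Determinants of unipotents, and a closed condition on determinants *)

Section SquareZero.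
Variables (k : fieldType) (d : nat) (a : 'M[k]_d).

(* det (1 + X a) is a unit of k[X], hence constant. *)
Lemma det_unipotent : a *m a = 0 -> \det (1%:M + a) = 1.
Proof.
move=> aa; pose A : 'M[{poly k}]_d := 1%:M + 'X *: map_mx polyC a.
have AA : A *m (1%:M - 'X *: map_mx polyC a) = 1%:M.
  by apply: unipotentK; rewrite -scalemxAl -scalemxAr -map_mxM aa map_mx0 !scaler0.
have Au : \det A \is a GRing.unit.
  by have [] := mulmx1_unit AA; rewrite unitmxE.
have detA t : (\det A).[t] = \det (1%:M + t *: a).
  rewrite -horner_evalE -det_map_mx; congr (\det _); apply/matrixP=> i j.
  by rewrite !mxE /= !horner_evalE hornerD hornerMn hornerC hornerM hornerX hornerC.
have /size_poly1P[c _ cE] : size (\det A) == 1%N by move: Au; rewrite poly_unitE => /andP[].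
have := detA 0; have := detA 1; rewrite cE !hornerC scale1r scale0r addr0 det1.
by move=> <- ->.
Qed.

End SquareZero.

Section ClosedDeterminant.
Variable K : numFieldType.

Lemma det_continuous d : continuous (fun M : 'M[K]_d => \det M).
Proof.
apply: continuous_big => [|s _]; first exact: add_continuous.
move=> M; apply: (@continuousM K _ (fun=> (-1) ^+ s) (fun x : 'M[K]_d => \prod_i x i (s i))).
  exact: cst_continuous.
move: M; apply: continuous_big => [|i _]; first exact: mul_continuous.
exact: coord_continuous.
Qed.

Lemma closed_det_pow1 d n : closed [set M : 'M[K]_d | \det M ^+ n = 1].
Proof.
have -> : [set M : 'M[K]_d | \det M ^+ n = 1] =
    (fun M : 'M[K]_d => \det M ^+ n) @^-1` [set 1] by [].
apply: closed_comp => [M _|]; last exact/accessible_closed_set1/hausdorff_accessible/(@norm_hausdorff K K^o).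
elim: n => [|n IH]; first exact: (@cst_continuous _ K 1).
have -> : (fun N : 'M[K]_d => \det N ^+ n.+1) = (fun N => \det N) \* (fun N => \det N ^+ n).
  by apply/funext=> N /=; rewrite exprS.
by apply: continuousM => //; exact: det_continuous.
Qed.

End ClosedDeterminant.

(** * Integrality of the weights *)

Section Weights.
Variable R : realType.
Local Notation C := R[i].
Local Notation V := (@V0 R).

(** In the weight basis, any nonzero coordinate of an eigenvector forces its eigenvalue to be the
    corresponding entry of [wts]. *)
Lemma is_weight_wts (W : wmod R) (l : C) : is_weight W l -> exists j, l = wts W 0 j.
Proof.
case=> v v0 Hv; have [uP HP _] := wmod_basis W.
pose y := invmx (wbasis W) *m v.
have Dy : diag_mx (wts W) *m y = l *: y.
  apply: (can_inj (mulKmx uP)); rewrite mulmxA -HP /y -mulmxA (mulKVmx uP) Hv.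
  by rewrite -scalemxAr (mulKVmx uP).
have vE : v = wbasis W *m y by rewrite /y mulKVmx.
clearbody y; have [y0|/cV0Pn[j yj]] := eqVneq y 0.
  by move: v0; rewrite vE y0 mulmx0 eqxx.
exists j; move/matrixP/(_ j 0): Dy; rewrite mul_diag_mx !mxE => /esym e.
exact: (mulIf yj).
Qed.

Lemma wts_tens (W W' : wmod R) a b :
  wts (tens W W') 0 (mxtens_index (a, b)) = wts W 0 a + wts W' 0 b.
Proof. by rewrite [LHS]mxE mxtens_indexK. Qed.

Lemma wts_tpow_V0 m j : exists z : int, wts (tpow V m) 0 j = m%:R + 2 * z%:~R.
Proof.
elim: m j => [|m IH] j; first by exists 0; rewrite !mxE mulr0 addr0.
case: (mxtens_indexP j) => a b; have [z zE] := IH b.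
rewrite -[tpow V m.+1]/(tens V (tpow V m)) wts_tens zE mxE.
case: a => [[|[|//]] ?] /=.
  by exists z; rewrite expr0 -(natr1 m); ring.
by exists (z - 1); rewrite expr1 -(natr1 m) rmorphB /=; ring.
Qed.

Lemma singular_tpow_V0 m : odd m -> singular (tpow V m).
Proof.
move=> om; right=> l /is_weight_wts[j ->]; have [z ->] := wts_tpow_V0 j.
(* For odd m, m = 1 + 2 (m / 2) with the integer half. *)
exists (m./2%:Z + z); rewrite -{1}(odd_double_half m) om rmorphD /= natrD -mul2n natrM.
by rewrite mulrDr addrA.
Qed.

Lemma singular_V0 : singular V.
Proof.
right=> l /is_weight_wts[j ->]; rewrite mxE.
case: j => [[|[|//]] ?] /=.
  by exists 0; rewrite expr0 mulr0 addr0.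
by exists (- 1); rewrite expr1 rmorphN /= rmorph1; ring.
Qed.

End Weights.

(** * The form and the unitary action on the Hom space; infinite image *)

Section IndefiniteForms.
Variables (K : numClosedFieldType) (V : vectType K) (h : hermitian_form V).

(** Nondegeneracy provides w pairing to 1 with v. For real c the value of the form on w + c v is h w
    w + 2 c, which takes every real value. *)
Lemma isotropic_indefinite (v : V) :
  nondegenerate h -> v != 0 -> h v v = 0 -> indefinite h.
Proof.
move=> nd v0 vv.
have [w vw] : exists w, h w v = 1.
  have : v \notin orthov h fullv by rewrite (eqP nd) memv0.
  case/mem_orthovPn=> w _; rewrite -/(h v w) => vw.
  exists ((h w v)^-1 *: w); rewrite linearZl /= mulVf // (hermC h) expr0 mul1r.
  by rewrite conjC_eq0.
have wv : h v w = 1 by rewrite (hermC h) vw expr0 mul1r rmorph1.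
have hw : Num.conj (h w w) = h w w by rewrite [in RHS](hermC h) expr0 mul1r.
have hE (c : K) : Num.conj c = c -> h (w + c *: v) (w + c *: v) = h w w + c *+ 2.
  move=> cc; rewrite linearDl !linearDr !linearZl !linearZr /= vw wv vv cc.
  by rewrite !mulr1 !mulr0 addr0 -addrA mulr2n.
have two : (2 : K) != 0 by rewrite pnatr_eq0.
have real (e : K) : Num.conj e = e -> Num.conj ((e - h w w) / 2) = (e - h w w) / 2.
  by move=> ee; rewrite rmorphM fmorphV rmorphB /= rmorph_nat ee hw.
have half (e : K) : h w w + (e - h w w) / 2 *+ 2 = e.
  by rewrite -mulr_natr divfK // addrC subrK.
(* The coefficients solve h w w + 2 c = 1 and h w w + 2 c = -1. *)
split; [exists (w + ((1 - h w w) / 2) *: v) | exists (w + ((-1 - h w w) / 2) *: v)].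
  by rewrite hE ?half ?ltr01 // real ?rmorph1.
by rewrite hE ?half ?ltrN10 // real // rmorphN rmorph1.
Qed.

End IndefiniteForms.

Section BraidAction.
Variables (R : realType) (n : nat).
Local Notation C := R[i].
Local Notation V := (@V0 R).
Local Notation m := (n.*2.+1).
Local Notation T := (tpow V m).
Local Notation zeta := (zeta R).
Local Notation HS := (Hspace R n).

Definition Hform (f g : HS) : C := hom_form (vsval f) (vsval g).

Lemma Hform_bilinear : bilinear_for *%R (Num.conj \; *%R) Hform.
Proof.
split=> [g c f f'|f c g g']; rewrite /Hform linearP.
  exact: hom_form_linearl.
exact: hom_form_linearr.
Qed.

HB.instance Definition _ := bilinear_isBilinear.Build C HS HS C *%R (Num.conj \; *%R)
  Hform Hform_bilinear.

Lemma Hform_hermitian (f g : HS) : Hform f g = (-1) ^+ false * Num.conj (Hform g f).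
Proof. by rewrite expr0 mul1r; exact: hom_form_sym. Qed.

HB.instance Definition _ := isHermitianSesquilinear.Build C HS false (@Num.conj C)
  Hform Hform_hermitian.

Definition hermitian_Hform : hermitian_form HS := Hform.

Lemma Hform_nondegenerate : nondegenerate hermitian_Hform.
Proof.
rewrite /nondegenerate -subv0; apply/subvP=> f /mem_orthovP f0; rewrite memv0; apply/eqP.
apply: val_inj; apply: (hom_form_nondegenerate (subvsP f)) => g gT.
by have := f0 (vsproj _ g) (memvf _); rewrite /= /Hform vsprojK.
Qed.

Lemma hook_end_subproof i f : f \in module_hom V T -> hook_at R m i *m f \in module_hom V T.
Proof. by apply: commutes_uq_module_hom; exact: hook_at_hom. Qed.

Definition hook_end (i : nat) : 'End(HS) :=
  linfun (vsproj (module_hom V T) \o mulmx (hook_at R m i) \o vsval).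

Lemma hook_endE i f : vsval (hook_end i f) = hook_at R m i *m vsval f.
Proof. by rewrite lfunE /= vsprojK // hook_end_subproof // subvsP. Qed.

Lemma hook_end_sqr i : (hook_end i \o hook_end i = 0)%VF.
Proof.
apply/lfunP=> f; apply: val_inj; rewrite /= comp_lfunE !hook_endE mulmxA hook_at_sqr.
by rewrite mul0mx zero_lfunE.
Qed.

Lemma Hform_indefinite : (0 < n)%N -> indefinite hermitian_Hform.
Proof.
move=> n0; have [f fT Nf] := hook_module_hom_neq0 R n0.
pose g : HS := vsproj (module_hom V T) f.
apply: (isotropic_indefinite (v := hook_end 0 g) Hform_nondegenerate).
  apply: contraNneq Nf => g0; have := hook_endE 0 g.
  by rewrite g0 /g vsprojK // => <-; rewrite linear0.
by rewrite /= /Hform hook_endE hom_form_hook.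
Qed.

Lemma braid_end_unitary b : unitary_group hermitian_Hform (@braid_end R n b).
Proof.
split; last by move=> f g; rewrite /= /Hform !word_endE hom_form_unitary.
apply/eqP; rewrite -subv0; apply/subvP=> f; rewrite memv_ker memv0 => /eqP bf.
have [rho1 rhoM] := braid_end_action R n.
have := rhoM (b^-1)%g b; rewrite mulVg rho1 => /lfunP/(_ f).
by rewrite id_lfunE comp_lfunE bf linear0 => ->.
Qed.

Lemma word_mx_nseq (i : 'I_m.-1) j :
  word_mx R (nseq j (i, true)) = zeta ^+ j *: (1%:M + j%:R *: hook_at R m i).
Proof.
elim: j => [|j IH]; first by rewrite expr0 !scale1r scale0r addr0.
rewrite -[nseq _ _]/(_ :: nseq j (i, true)) /= IH /letter_mx /=.
have := hook_at_sqr R m i; move: (hook_at R m i) => a aa.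
rewrite -scalemxAl -scalemxAr scalerA -exprS; congr (_ *: _).
rewrite mulmxDl !mulmxDr !mul1mx !mulmx1 -scalemxAr aa scaler0 addr0 mulrS scalerDl.
by rewrite scale1r -addrA [a + _]addrC.
Qed.

Lemma braid_end_infinite : (0 < n)%N -> infinite_set (range (@braid_end R n)).
Proof.
move=> n0; have [f fT Nf] := hook_module_hom_neq0 R n0.
have im : (0 < m.-1)%N by case: (n) n0.
pose s j := braid_end R (braid_of (nseq (8 * j) (Ordinal im, true))).
have sE j : vsval (s j (vsproj _ f)) = f + (8 * j)%:R *: (hook_at R m 0 *m f).
  rewrite /s braid_end_of word_endE word_mx_nseq exprM zeta8 expr1n scale1r vsprojK //.
  by rewrite mulmxDl mul1mx -scalemxAl.
have s_inj : injective s.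
  move=> j l /(congr1 (fun g : 'End(HS) => vsval (g (vsproj _ f)))); rewrite !sE.
  move/addrI/eqP; rewrite -subr_eq0 -scalerBl scaler_eq0 (negPf Nf) orbF subr_eq0.
  by rewrite eqr_nat eqn_pmul2l // => /eqP.
move=> fin; apply: infinite_nat.
rewrite (_ : setT = s @^-1` range (@braid_end R n)).
  by apply: finite_preimage fin => j l _ _; exact: s_inj.
by apply/seteqP; split=> // j _; exists (braid_of (nseq (8 * j) (Ordinal im, true))).
Qed.

End BraidAction.

(** * Failure of density by determinants *)

Section EndMatrices.
Variables (K : numClosedFieldType) (V : vectType K).
Implicit Types f g : 'End(V).

(** The order is reversed because [mxof] uses row vectors; determinants do not see this. *)
Lemma end_mx_comp f g : end_mx (f \o g)%VF = end_mx g *m end_mx f.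
Proof. by apply: passmx.mxof_comp; exact: vbasisP. Qed.

Lemma end_mx1 : end_mx (\1%VF : 'End(V)) = 1%:M.
Proof. by rewrite /end_mx passmx.mxof1 // (basis_free (vbasisP fullv)). Qed.

Lemma end_mx_linear : linear (@end_mx K V).
Proof. exact: passmx.mxof_linear. Qed.

HB.instance Definition _ := GRing.isSemilinear.Build K 'End(V) 'M[K]_(\dim {:V}) *:%R
  (@end_mx K V) (GRing.semilinear_linear end_mx_linear).

Lemma det_end_mx_unipotent (c : K) f :
  (f \o f = 0)%VF -> \det (end_mx (c *: (\1%VF + f))) = c ^+ \dim {:V}.
Proof.
move=> ff; rewrite linearZ /= detZ linearD /= end_mx1.
rewrite det_unipotent ?mulr1 //.
by rewrite -end_mx_comp ff linear0.
Qed.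

Lemma unit_scalar_unitary (h : hermitian_form V) (u : K) :
  `|u| = 1 -> unitary_group h (u *: \1%VF).
Proof.
move=> u1; have u0 : u != 0 by rewrite -normr_eq0 u1 oner_eq0.
split=> [|v w].
  apply/eqP; rewrite -subv0; apply/subvP=> v; rewrite memv_ker memv0.
  by rewrite scale_lfunE id_lfunE scaler_eq0 (negPf u0).
rewrite !scale_lfunE !id_lfunE linearZl linearZr /= mulrA.
by rewrite -normCK u1 expr1n mul1r.
Qed.

Lemma scalar_not_in_det_closure (S : set 'End(V)) (n : nat) : (0 < n)%N ->
  (0 < \dim {:V})%N -> (forall g, S g -> \det (end_mx g) ^+ n = 1) ->
  exists2 u : K, `|u| = 1 & ~ end_closure S (u *: \1%VF).
Proof.
move=> n0 d0 detS; set d := \dim {:V} in d0.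
have dn0 : (0 < d * n)%N by rewrite muln_gt0 d0.
(* The determinant of the scalar u is u^d, whose n-th power is then -1 instead of 1. *)
pose u : K := ((d * n).-root (-1))%R; have uE : u ^+ (d * n) = -1 by rewrite rootCK.
exists u.
  by apply/eqP; rewrite -(@pexpr_eq1 _ _ (d * n)) // -normrX uE normrN1.
move=> cl; have : closure [set M : 'M[K]_d | \det M ^+ n = 1] (end_mx (u *: \1%VF : 'End(V))).
  by apply: closureS cl => _ [g Sg <-]; exact: detS.
move/(@closed_det_pow1 K d n) => /=.
rewrite linearZ /= end_mx1 detZ det1 mulr1 -exprM uE => /eqP.
by rewrite eq_sym -subr_eq0 opprK -mulr2n pnatr_eq0.
Qed.

End EndMatrices.

(** The determinant is multiplicative along a word, and each letter contributes a power of zeta or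
    of its inverse, both 8-th roots of unity. *)
Lemma det_braid_end (R : realType) n (b : braid_group n.*2.+1) :
  \det (end_mx (braid_end R b)) ^+ 8 = 1.
Proof.
rewrite /braid_end; elim: (repr b) => [|[i s] w IH].
  rewrite (_ : word_end R [::] = \1%VF) ?end_mx1 ?det1 ?expr1n //.
  by apply/lfunP=> f; apply: val_inj; rewrite /= word_endE mul1mx id_lfunE.
rewrite (_ : word_end R _ = (word_end R [:: (i, s)] \o word_end R w)%VF); last first.
  by apply/lfunP=> f; apply: val_inj; rewrite /= comp_lfunE !word_endE /= mulmx1 mulmxA.
rewrite end_mx_comp det_mulmx exprMn IH mul1r.
have NN : (- hook_end R n i \o - hook_end R n i = 0)%VF.
  by rewrite comp_lfunNl comp_lfunNr opprK hook_end_sqr.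
have -> : word_end R [:: (i, s)] = if s then zeta R *: (\1%VF + hook_end R n i)
    else (zeta R)^-1 *: (\1%VF - hook_end R n i).
  apply/lfunP=> f; apply: val_inj; rewrite /= word_endE /= mulmx1 /letter_mx /=.
  case: s; rewrite scale_lfunE add_lfunE ?opp_lfunE id_lfunE.
    by rewrite [RHS]linearZ -scalemxAl [in RHS]linearD mulmxDl mul1mx /= hook_endE.
  by rewrite [RHS]linearZ -scalemxAl [in RHS]linearB mulmxBl mul1mx /= hook_endE.
have zV8 : (zeta R)^-1 ^+ 8 = 1 by rewrite exprVn zeta8 invr1.
have [dp dm] := (@det_end_mx_unipotent _ (Hspace R n) (zeta R) _ (hook_end_sqr R n i),
  @det_end_mx_unipotent _ (Hspace R n) (zeta R)^-1 _ NN).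
by case: s; rewrite ?dp ?dm -exprM mulnC exprM ?zeta8 ?zV8 expr1n.
Qed.

Theorem mainTheorem5 (R : realType) (n : nat) (hn : (0 < n)%N) :
  singular (@V0 R) /\ singular (tpow (@V0 R) n.*2.+1) /\
  exists rho : braid_group n.*2.+1 -> 'End(Hspace R n),
    linear_action rho /\
    (forall (i : 'I_(n.*2.+1).-1) (f : Hspace R n),
      vsval (rho (braid_gen i) f) = braid_at V0 n.*2.+1 i *m vsval f) /\
    exists h : hermitian_form (Hspace R n),
      [/\ nondegenerate h /\ indefinite h,
          (forall b, unitary_group h (rho b)),
          infinite_set (range rho) &
          ~ (unitary_group h `<=` end_closure (range rho))].
Proof.
split; first exact: singular_V0.
split; first by apply: singular_tpow_V0; rewrite /= odd_double.
exists (@braid_end R n); split; first exact: braid_end_action.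
split; first exact: braid_end_gen.
exists (@hermitian_Hform R n); split.
- by split; [exact: Hform_nondegenerate | exact: Hform_indefinite].
- exact: braid_end_unitary.
- exact: braid_end_infinite.
(* In dimension 0 the determinant condition would exclude nothing; a vector on which the form is
   positive rules this case out. *)
have d0 : (0 < \dim {:Hspace R n})%N.
  have [[v vv] _] := @Hform_indefinite R n hn.
  rewrite lt0n dimv_eq0; apply/eqP=> HS0; move: vv.
  have /eqP-> : v == 0 by rewrite -memv0 -HS0 memvf.
  by rewrite linear0l ltxx.
have [|u u1 ncl] := @scalar_not_in_det_closure _ _ (range (@braid_end R n)) 8 isT d0.
  by move=> _ [b _ <-]; exact: det_braid_end.
by move=> /(_ _ (unit_scalar_unitary (@hermitian_Hform R n) u1)).
Qed.
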